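(* Let $f(x,y,z)=y^2+z^2+Ax^2+Bxy+Cxz+Dyz\in\mathbb{Z}[x,y,z]$ satisfy $f(n,k,\ell)\ge0$ for all integers $n,k,\ell\ge0$, and let $a_n(q)=\sum_{0\le\ell\le k\le n,\ n\le k+\ell}{n\brack k}_q^2{n\brack\ell}_q{k\brack\ell}_q{k+\ell\brack n}_qq^{f(n,k,\ell)}$. For $P\in\mathbb{C}[x,y,z]$ put $a_{n,P}=\sum_{k,\ell}\binom{n}{k}^2\binom{n}{\ell}\binom{k}{\ell}\binom{k+\ell}{n}P(n,k,\ell)$. Let $L = xz-y^2-z^2+\frac{3xy+yz-x^2}{2}+f(x,y,z)$, $Q_1 = L^2+\frac{x^2y-xy^2+2xyz+y^2z-yz^2}{12}+\frac{-x^2+xy-y^2-z^2+zy+zx}{6}$, $Q_2 = \frac{1}{12}(7x^2-17xy+12y^2-12xz-7zy+12z^2)-f(x,y,z)$. For all $n\ge1$ and $\omega\in\mu_n$, writing $e=\mathrm{ord}(\omega)$: $a_n(\omega)=a_{n/e}(1)$, $\omega a_n'(\omega)=e^2a_{n/e,L}$, $\omega^2a_n''(\omega)=e^4a_{n/e,Q_1}+e^2a_{n/e,Q_2}$. In particular, for all $m\ge1$ and $n\ge2$ with $\gcd(n,6)=1$, $a_{nm}(q)\equiv f_0(q)+f_1(q)[n]_q+f_2(q)[n]_q^2\pmod{[n]_q^3}$, where $f_0,f_1,f_2\in\mathbb{Z}[q]$ are the first three $[n]_q$-digits of $a_{nm}(q)$, given by $f_0 = G_{g_0,n}$, $f_1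 = \frac{q-1}{n}\big(G_{g_1,n}-qG_{g_0,n}'\big)$, $f_2 = \frac{(q-1)^2}{2n^2}\big(G_{g_2,n}+G''_{g_0,n}q^2+(qG'_{g_0,n}-G_{g_1,n})(n-1)+2q(G'_{g_0,n}-G'_{g_1,n})\big)$, with $g_0(d)=a_{md}(1)$, $g_1(d)=a_{mn}'(\omega_n^d)\omega_n^d$, $g_2(d)=a_{mn}''(\omega_n^d)\omega_n^{2d}$ for $d\in D_n$.
   Context: $[n]_q = \frac{q^n-1}{q-1}$, ${n \brack k}_q = \frac{[n]_q!}{[k]_q![n-k]_q!}$ with $[n]_q!=\prod_{i=1}^n[i]_q$; ordinary binomials $\binom{a}{b}$ are $0$ unless $0\le b\le a$, and sums over $k,\ell$ range over all nonnegative integers. $\omega_n=e^{2\pi i/n}$, $\mu_n=\{\omega_n^j\}$, $\mathrm{ord}(\omega)$ is the order of $\omega$; primes denote derivatives in $q$. $\mu$ is the Möbius function, $D_n$ the set of divisors of $n$ other than $n$, and for $g:D_n\to\mathbb{C}$, $G_{g,n}(q)=\sum_{d\in D_n}\frac{[n]_q}{[n/d]_q}\cdot\frac{\sum_{e\mid d}\mu(d/e)g(e)}{d}$. For $F\in\mathbb{C}[q]$ and $n>1$, writing uniquely $F=\sum_{i\ge0}f_i[n]_q^i$ with $\deg f_i<n-1$, $f_i$ is the $i$-th $[n]_q$-digit of $F$. *)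

(* Defs.v *)
From HB Require Import structures.
From mathcomp Require Import all_boot all_order all_algebra.
From mathcomp Require Import complex mpoly reals.
(* [trigo] is not imported: the notations it brings clash with those of
   [mpoly]. *)
From mathcomp Require trigo.

Set Implicit Arguments.
Unset Strict Implicit.
Unset Printing Implicit Defensive.

Import Order.TTheory GRing.Theory Num.Theory.
Local Open Scope ring_scope.

(* The divisors are monic and both divisions are exact over the integers, so
   the pseudo-division [%/] of {poly int} returns the true quotient. *)
Definition qint (n : nat) : {poly int} := ('X^n - 1) %/ ('X - 1).

Definition qfact (n : nat) : {poly int} := \prod_(1 <= i < n.+1) qint i.

Definition qbin (n k : nat) : {poly int} :=
  if (k <= n)%N then qfact n %/ (qfact k * qfact (n - k)) else 0.

Definition toC (R : realType) (p : {poly int}) : {poly R[i]} :=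
  map_poly intr p.

(* e^(2 i pi / n) *)
Definition omega (R : realType) (n : nat) : R[i] :=
  Complex (trigo.cos (2 * trigo.pi / n%:R)) (trigo.sin (2 * trigo.pi / n%:R)).

Definition in_mu (R : realType) (n : nat) (w : R[i]) : Prop :=
  exists j : nat, w = omega R n ^+ j.

Section Trivariate.

Variable S : nzRingType.

Definition x : {mpoly S[3]} := 'X_(0 : 'I_3).
Definition y : {mpoly S[3]} := 'X_(1 : 'I_3).
Definition z : {mpoly S[3]} := 'X_(2 : 'I_3).

End Trivariate.

Arguments x {S}.
Arguments y {S}.
Arguments z {S}.

Definition eval3 (S : comNzRingType) (P : {mpoly S[3]}) (n k l : nat) : S :=
  P.@[tnth [tuple n%:R; k%:R; l%:R]].

Definition fpoly (A B C D : int) : {mpoly int[3]} :=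
  y ^+ 2 + z ^+ 2 + A *: x ^+ 2 + B *: (x * y) + C *: (x * z) + D *: (y * z).

(* The absolute value only serves to read the exponent f(n,k,l) as a natural
   number: it is used for f taking nonnegative values. *)
Definition a (f : {mpoly int[3]}) (n : nat) : {poly int} :=
  \sum_(k < n.+1) \sum_(l < n.+1 | (l <= k)%N && (n <= k + l)%N)
     qbin n k ^+ 2 * qbin n l * qbin k l * qbin (k + l) n
     * 'X^(`|eval3 f n k l|%N).

(* The terms with k > n or l > n vanish, because of 'C(n, k) and 'C(n, l). *)
Definition aP (R : realType) (n : nat) (P : {mpoly R[i][3]}) : R[i] :=
  \sum_(k < n.+1) \sum_(l < n.+1)
     ('C(n, k) ^ 2 * 'C(n, l) * 'C(k, l) * 'C(k + l, n))%:R * eval3 P n k l.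

Section CorrectionPolynomials.

Variables (R : realType) (f : {mpoly int[3]}).

Definition fC : {mpoly R[i][3]} := map_mpoly intr f.

Definition L : {mpoly R[i][3]} :=
  x * z - y ^+ 2 - z ^+ 2 + 2^-1 *: (3 *: (x * y) + y * z - x ^+ 2) + fC.

Definition Q1 : {mpoly R[i][3]} :=
  L ^+ 2
  + 12^-1 *: (x ^+ 2 * y - x * y ^+ 2 + 2 *: (x * y * z) + y ^+ 2 * z
              - y * z ^+ 2)
  + 6^-1 *: (- x ^+ 2 + x * y - y ^+ 2 - z ^+ 2 + z * y + z * x).

Definition Q2 : {mpoly R[i][3]} :=
  12^-1 *: (7 *: x ^+ 2 - 17 *: (x * y) + 12 *: y ^+ 2 - 12 *: (x * z)
            - 7 *: (z * y) + 12 *: z ^+ 2)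
  - fC.

End CorrectionPolynomials.

Definition mobius (n : nat) : int :=
  if all (fun p => logn p n == 1%N) (primes n)
  then (-1) ^+ size (primes n) else 0.

Definition G (R : realType) (g : nat -> R[i]) (n : nat) : {poly R[i]} :=
  \sum_(d <- divisors n | d != n)
     ((\sum_(e <- divisors d) (mobius (d %/ e))%:~R * g e) / d%:R)
       *: (toC R (qint n) %/ toC R (qint (n %/ d))).

(* [s] lists f_0, f_1, ... up to some rank, after which all f_i are zero;
   deg f_i < n - 1 reads size f_i < n. *)
Definition digit_expansion (R : realType) (n : nat) (F : {poly R[i]})
    (s : seq {poly R[i]}) : Prop :=
  (forall i : nat, (size (s`_i)%R < n)%N) /\
  F = \sum_(i < size s) s`_i * toC R (qint n) ^+ i.

Definition is_digit (R : realType) (n : nat) (F : {poly R[i]}) (i : nat)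
    (h : {poly R[i]}) : Prop :=
  exists2 s, digit_expansion n F s & h = s`_i.

Definition congr_poly (p q m : {poly int}) : Prop :=
  exists r : {poly int}, p - q = r * m.

(* Main.v *)
(** Write theta = q d/dq. At a primitive e-th root of unity w the value and the
    first two logarithmic theta-derivatives of [eN choose eK]_q can be computed
    exactly: [eN]_q! splits into N blocks of e consecutive factors, each block
    being X^e - 1 times a polynomial that does not vanish at w, and these data
    are additive under products. The sums over the e-th roots of unity that
    occur come from the same data, at 1, of [e]_q = prod (X - w^i). In a_n(q)
    the terms with e | k and e | l give all of the formulas except for a part of
    the second derivative. A term with exactly one of k, l not divisible by e
    has a double zero at w, hence enters only the second derivative, where its
    two simple zeros and the summand k^2 + l^2 of the exponent f combine to a
    multiple of w^r / (w^r - 1)^2, r being the residue. All other terms have a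
    zero of order at least 3.

    For the digits, Moebius inversion shows that G_{g,n} takes the value
    g(gcd(j,n)) at omega_n^j. The digits f_0, f_1, f_2 are determined one after
    the other by interpolation at the nontrivial n-th roots of unity, since by
    the first part the values of a_{nm} and of its derivatives there depend only
    on gcd(j,n). The degree bounds hold because gcd(n,6) = 1 forces n/d >= 5 for
    d in D_n. *)

Require Import Defs.
From HB Require Import structures.
From mathcomp Require Import all_boot all_order all_algebra ring lra zify.
From mathcomp Require Import complex mpoly reals.
From mathcomp Require trigo.

Set Implicit Arguments.
Unset Strict Implicit.
Unset Printing Implicit Defensive.

Import Order.TTheory GRing.Theory Num.Theory.
Local Open Scope ring_scope.

(** * q-binomial coefficients *)

Lemma map_Xnsub1 (F : nzRingType) (n : nat) :
  map_poly (intr : int -> F) ('X^n - 1) = 'X^n - 1.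
Proof. by rewrite rmorphB rmorph1 /= map_polyXn. Qed.

Lemma qint_sum (n : nat) : qint n = \sum_(i < n) 'X^i.
Proof.
rewrite /qint subrX1 mulrC Pdiv.IdomainMonic.mulpK //.
by rewrite -polyC1 monicXsubC.
Qed.

Lemma qint_mulXsub1 (n : nat) : ('X - 1) * qint n = 'X^n - 1.
Proof. by rewrite qint_sum -subrX1. Qed.

Lemma size_qint (n : nat) : size (qint n) = n.
Proof.
case: n => [|n]; first by rewrite qint_sum big_ord0 size_poly0.
have H := qint_mulXsub1 n.+1.
have : size (('X - 1) * qint n.+1) = n.+2.
  by rewrite H -polyC1 size_XnsubC.
have nz : qint n.+1 != 0.
  apply/eqP => E; move: H; rewrite E mulr0 => /esym/eqP.
  by rewrite -size_poly_eq0 -polyC1 size_XnsubC.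
by rewrite -polyC1 size_monicM ?monicXsubC // size_XsubC => -[].
Qed.

Lemma qint_monic (n : nat) : (0 < n)%N -> qint n \is monic.
Proof.
move=> n0; have := qint_mulXsub1 n => H.
have : ('X - 1) * qint n \is monic by rewrite H -polyC1 monicXnsubC.
by rewrite monicMl // -polyC1 monicXsubC.
Qed.

Lemma qfactS (n : nat) : qfact n.+1 = qfact n * qint n.+1.
Proof. by rewrite /qfact big_nat_recr. Qed.

Lemma qfact0 : qfact 0 = 1.
Proof. by rewrite /qfact big_geq. Qed.

Lemma qfact_monic (n : nat) : qfact n \is monic.
Proof.
elim: n => [|n IHn]; first by rewrite qfact0 monic1.
by rewrite qfactS monicMl // qint_monic.
Qed.

(* By the q-Pascal rule, which comes from [n+1] = [k] + q^k [n+1-k]. *)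
Lemma qfact_dvd (n k : nat) :
  (k <= n)%N -> exists b, qfact n = b * (qfact k * qfact (n - k)).
Proof.
elim: n k => [|n IHn] k kn.
  by move: kn; rewrite leqn0 => /eqP ->; exists 1; rewrite subnn qfact0 !mulr1.
case: k kn => [|k] kn; first by exists 1; rewrite subn0 qfact0 !mul1r.
have split_qint : qint n.+1 = qint k.+1 + 'X^(k.+1) * qint (n - k).
  apply: (mulfI (_ : 'X - 1 != 0)).
    by rewrite -polyC1 polyXsubC_eq0.
  rewrite mulrDr mulrCA !qint_mulXsub1 mulrBr mulr1 -exprD.
  by rewrite (_ : k.+1 + (n - k) = n.+1)%N; [ring | lia].
have [b1 E1] := IHn k kn.
case: (ltnP k n) => kn'; last first.
  have -> : k = n by lia.
  by exists 1; rewrite subnn qfact0 mulr1 mul1r.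
have [b2 E2] := IHn k.+1 kn'.
exists (b1 + 'X^(k.+1) * b2).
rewrite qfactS split_qint mulrDr {1}E1 E2 subSS qfactS.
have -> : (n - k = (n - k.+1).+1)%N by lia.
by rewrite qfactS; ring.
Qed.

Lemma qbin_mul_qfact (n k : nat) :
  (k <= n)%N -> qbin n k * (qfact k * qfact (n - k)) = qfact n.
Proof.
move=> kn; rewrite /qbin kn; have [b {1 2}->] := qfact_dvd kn.
by rewrite Pdiv.IdomainMonic.mulpK // monicMl // qfact_monic.
Qed.

(** This is (q-1)^n [n]_q!. The powers of q-1 cancel in q-binomials, and each factor q^i - 1 is easy
    to evaluate and differentiate at a root of unity. *)
Definition qfactX (F : nzRingType) (n : nat) : {poly F} :=
  \prod_(i < n) ('X^(i.+1) - 1).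

Definition qbinF (F : nzRingType) (n k : nat) : {poly F} :=
  map_poly intr (qbin n k).

Section QBinomial.

Variable F : numFieldType.

Implicit Types n k e N K : nat.

Lemma Xnsub1_neq0 n : (0 < n)%N -> 'X^n - 1 != 0 :> {poly F}.
Proof. by move=> n0; apply: monic_neq0; rewrite -polyC1 monicXnsubC. Qed.

Lemma qfactXS n : qfactX F n.+1 = qfactX F n * ('X^(n.+1) - 1).
Proof. by rewrite /qfactX big_ord_recr. Qed.

Lemma qfactX_neq0 n : qfactX F n != 0.
Proof. by apply/prodf_neq0 => i _; rewrite Xnsub1_neq0. Qed.

Lemma qfactXE n : qfactX F n = map_poly intr (qfact n) * ('X - 1) ^+ n.
Proof.
elim: n => [|n IHn].
  by rewrite qfact0 rmorph1 mulr1 /qfactX big_ord0.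
rewrite qfactXS IHn qfactS rmorphM [('X - 1) ^+ n.+1]exprS /=.
have -> : 'X^(n.+1) - 1 = ('X - 1) * map_poly intr (qint n.+1) :> {poly F}.
  rewrite -map_Xnsub1 -qint_mulXsub1 rmorphM; congr (_ * _).
  by rewrite rmorphB rmorph1 /= map_polyX.
by ring.
Qed.

Lemma qbinF_gt n k : (n < k)%N -> qbinF F n k = 0.
Proof. by rewrite /qbinF /qbin => /ltn_geF ->; rewrite rmorph0. Qed.

Lemma qbinF_mul n k :
  (k <= n)%N -> qbinF F n k * (qfactX F k * qfactX F (n - k)) = qfactX F n.
Proof.
move=> kn; rewrite !qfactXE -(qbin_mul_qfact kn) !rmorphM /=.
have -> : ('X - 1) ^+ n = ('X - 1) ^+ k * ('X - 1) ^+ (n - k) :> {poly F}.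
  by rewrite -exprD subnKC.
by rewrite /qbinF; ring.
Qed.

(** This relation and the two after it shift one or both indices by one. Being free of division,
    they can be evaluated at roots of unity; for k > n both sides vanish. *)
Lemma qbinF_SS n k :
  qbinF F n.+1 k.+1 * ('X^(k.+1) - 1) = ('X^(n.+1) - 1) * qbinF F n k.
Proof.
case: (leqP k n) => kn; last by rewrite !qbinF_gt // mulr0 mul0r.
apply: (mulIf (mulf_neq0 (qfactX_neq0 k) (qfactX_neq0 (n - k)))).
have := qbinF_mul (kn : k.+1 <= n.+1)%N; rewrite subSS !qfactXS.
by rewrite -(qbinF_mul kn) => H; apply: etrans (etrans _ H) _; ring.
Qed.

Lemma qbinF_S n k :
  qbinF F n.+1 k * ('X^(n.+1 - k) - 1) = ('X^(n.+1) - 1) * qbinF F n k.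
Proof.
case: (ltngtP k n.+1) => [kn|kn|->]; last first.
- by rewrite subnn expr0 subrr mulr0 [qbinF F n _]qbinF_gt ?mulr0.
- by rewrite !qbinF_gt ?mulr0 ?mul0r //; lia.
rewrite ltnS in kn.
apply: (mulIf (mulf_neq0 (qfactX_neq0 k) (qfactX_neq0 (n - k)))).
have := qbinF_mul (leqW kn); rewrite subSn // !qfactXS.
by rewrite -(qbinF_mul kn) => H; apply: etrans (etrans _ H) _; ring.
Qed.

Lemma qbinF_Sr n k :
  qbinF F n k.+1 * ('X^(k.+1) - 1) = qbinF F n k * ('X^(n - k) - 1).
Proof.
case: n => [|n].
  by rewrite sub0n expr0 subrr mulr0 qbinF_gt // mul0r.
case: (ltngtP k n.+1) => [kn|kn|->]; last first.
- by rewrite subnn expr0 subrr mulr0 qbinF_gt // mul0r.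
- by rewrite !qbinF_gt ?mul0r //; lia.
by rewrite qbinF_SS qbinF_S.
Qed.

End QBinomial.

(** * Logarithmic derivatives at a point *)

(** Each monomial q^n is an eigenvector with eigenvalue n, so differentiation does not shift the
    powers of a root of unity. *)
HB.lock Definition theta (F : nzRingType) (p : {poly F}) : {poly F} :=
  'X * p^`().

(* [u] and [v] are the first two logarithmic derivatives, for the derivation
   theta, of [p] at [w]: they are additive under products. The condition still
   makes sense when [c = 0], where it says that p, theta p and theta^2 p vanish
   at [w]. *)
Definition jet (F : nzRingType) (w : F) (p : {poly F}) (c u v : F) : Prop :=
  [/\ p.[w] = c, (theta p).[w] = c * u &
      (theta (theta p)).[w] = c * (u ^+ 2 + v)].

Section Jets.

Variables (F : numFieldType) (w : F).

Implicit Types (p q r : {poly F}) (c u v : F) (n : nat).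

Lemma thetaD p q : theta (p + q) = theta p + theta q.
Proof. by rewrite !theta.unlock derivD mulrDr. Qed.

Lemma theta0 : theta 0 = 0 :> {poly F}.
Proof. by rewrite !theta.unlock deriv0 mulr0. Qed.

Lemma theta_sum (I : Type) (s : seq I) (P : pred I) (f : I -> {poly F}) :
  theta (\sum_(i <- s | P i) f i) = \sum_(i <- s | P i) theta (f i).
Proof. exact: (big_morph _ thetaD theta0). Qed.

Lemma thetaM p q : theta (p * q) = theta p * q + p * theta q.
Proof. by rewrite !theta.unlock derivM; ring. Qed.

Lemma theta2M p q :
  theta (theta (p * q))
  = theta (theta p) * q + 2 *: (theta p * theta q) + p * theta (theta q).
Proof.
by rewrite (thetaM p q) thetaD (thetaM (theta p)) (thetaM p) scaler_nat; ring.
Qed.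

Lemma thetaC c : theta c%:P = 0.
Proof. by rewrite theta.unlock derivC mulr0. Qed.

Lemma thetaXn n : theta 'X^n = n%:R *: 'X^n :> {poly F}.
Proof.
rewrite !theta.unlock derivXn scaler_nat; case: n => [|n].
  by rewrite !mulr0n mulr0.
by rewrite mulrnAr -exprS.
Qed.

Lemma thetaZ c p : theta (c *: p) = c *: theta p.
Proof. by rewrite !theta.unlock derivZ scalerAr. Qed.

Lemma horner_theta p : (theta p).[w] = w * p^`().[w].
Proof. by rewrite !theta.unlock hornerM hornerX. Qed.

Lemma horner_theta2 p :
  (theta (theta p)).[w] = w ^+ 2 * p^`(2).[w] + w * p^`().[w].
Proof.
rewrite !theta.unlock derivM derivX mul1r /derivn /=.
rewrite !(hornerM, hornerD, hornerX).
by ring.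
Qed.

Lemma jet1 : jet w 1 1 0 0.
Proof.
by split; rewrite ?thetaC ?theta0 ?hornerC ?horner0 ?mulr0 ?expr0n ?addr0
                  ?mulr0.
Qed.

Lemma jet0 u v : jet w 0 0 u v.
Proof. by split; rewrite ?theta0 ?horner0 ?mul0r. Qed.

Lemma jetXn n : jet w 'X^n (w ^+ n) n%:R 0.
Proof.
by split; rewrite ?thetaXn ?thetaZ ?thetaXn ?hornerZ ?hornerXn; ring.
Qed.

Lemma jetM p q c u v c' u' v' :
  jet w p c u v -> jet w q c' u' v' ->
  jet w (p * q) (c * c') (u + u') (v + v').
Proof.
move=> [p0 p1 p2] [q0 q1 q2]; split.
- by rewrite hornerM p0 q0.
- by rewrite thetaM !(hornerD, hornerM) p0 p1 q0 q1; ring.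
- by rewrite theta2M !(hornerD, hornerM, hornerZ) p0 p1 p2 q0 q1 q2; ring.
Qed.

Lemma jet_prod (I : eqType) (s : seq I) (p : I -> {poly F}) (c u v : I -> F) :
  {in s, forall i, jet w (p i) (c i) (u i) (v i)} ->
  jet w (\prod_(i <- s) p i) (\prod_(i <- s) c i) (\sum_(i <- s) u i)
    (\sum_(i <- s) v i).
Proof.
elim: s => [|i s IHs] H; first by rewrite !big_nil; apply: jet1.
rewrite !big_cons; apply: jetM; first by apply: H; rewrite mem_head.
by apply: IHs => j js; apply: H; rewrite in_cons js orbT.
Qed.

(** The product rules for theta and theta^2 are solved for the data of p, which is possible because
    q does not vanish at w. This handles quotients without dividing polynomials. *)
Lemma jetM_inv p q c u v c' u' v' :
  c' != 0 -> jet w q c' u' v' -> jet w (p * q) c u v ->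
  jet w p (c / c') (u - u') (v - v').
Proof.
move=> nz [q0 q1 q2] [].
rewrite theta2M thetaM !(hornerD, hornerM, hornerZ) q0 q1 q2 => <- e1 e2.
have e1' : (theta p).[w] = p.[w] * (u - u').
  by apply: (mulIf nz); rewrite -[LHS](addrK (p.[w] * (c' * u'))) e1; ring.
have e2' : (theta (theta p)).[w] = p.[w] * ((u - u') ^+ 2 + (v - v')).
  apply: (mulIf nz); move: e2; rewrite e1' => e2.
  apply: (addIr (2 * (p.[w] * (u - u') * (c' * u'))
                 + p.[w] * (c' * (u' ^+ 2 + v')))).
  by rewrite addrA e2; ring.
by rewrite mulfK // in e1' e2' *.
Qed.

Lemma jet_inj p c u v c' u' v' :
  c != 0 -> jet w p c u v -> jet w p c' u' v' -> [/\ c = c', u = u' & v = v'].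
Proof.
move=> nz [p0 p1 p2] [q0 q1 q2].
have e0 : c = c' by rewrite -p0.
have e1 : u = u' by apply: (mulfI nz); rewrite -p1 q1 e0.
split=> //; apply: (addrI (u ^+ 2)); apply: (mulfI nz).
by rewrite -p2 q2 e0 e1.
Qed.

(** By the Leibniz rule, only the terms with one theta on p and one on q survive. *)
Lemma theta_sqr_zero p q r :
  p.[w] = 0 -> q.[w] = 0 ->
  [/\ (p * q * r).[w] = 0, (theta (p * q * r)).[w] = 0 &
      (theta (theta (p * q * r))).[w]
      = 2 * ((theta p).[w] * (theta q).[w]) * r.[w]].
Proof.
move=> p0 q0; rewrite theta2M (thetaM (p * q)) (theta2M p) (thetaM p).
by split; rewrite !(hornerD, hornerM, hornerZ) p0 q0; ring.
Qed.

(** The last entry is theta applied to the logarithmic derivative n q^n / (q^n - 1). *)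
Lemma jet_Xnsub1 n : w ^+ n != 1 ->
  jet w ('X^n - 1) (w ^+ n - 1) (n%:R * (w ^+ n / (w ^+ n - 1)))
    (- n%:R ^+ 2 * (w ^+ n / (w ^+ n - 1) ^+ 2)).
Proof.
rewrite -subr_eq0 => nz.
have tE : theta ('X^n - 1) = n%:R *: 'X^n :> {poly F}.
  by rewrite thetaD thetaXn -polyCN thetaC addr0.
by split; rewrite ?tE ?thetaZ ?thetaXn ?hornerD ?hornerN ?hornerC ?hornerZ
                  ?hornerXn //; field.
Qed.

End Jets.

Lemma sum_nat_ord (F : numFieldType) n :
  \sum_(i < n) i%:R = n%:R * (n%:R - 1) / 2 :> F.
Proof.
elim: n => [|n IHn]; first by rewrite big_ord0 !mul0r.
by rewrite big_ord_recr /= IHn -addn1 natrD; field.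
Qed.

Lemma sum_sqr_ord (F : numFieldType) n :
  \sum_(i < n) i%:R ^+ 2 = n%:R * (n%:R - 1) * (2 * n%:R - 1) / 6 :> F.
Proof.
elim: n => [|n IHn]; first by rewrite big_ord0 !mul0r.
by rewrite big_ord_recr /= IHn -addn1 natrD; field.
Qed.

(** All the monomials equal 1 at w, so the entries are the number, the mean and the variance of the
    exponents ei with 0 <= i <= n. *)
Lemma jet_geom (F : numFieldType) (w : F) (e n : nat) : w ^+ e = 1 ->
  jet w (\sum_(i < n.+1) 'X^(e * i)) n.+1%:R (e%:R * n%:R / 2)
    (e%:R ^+ 2 * (n.+1%:R ^+ 2 - 1) / 12).
Proof.
move=> we; have E i : w ^+ (e * i) = 1 by rewrite exprM we expr1n.
split; rewrite ?theta_sum ?horner_sum.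
- under eq_bigr => i _ do rewrite hornerXn E.
  by rewrite sumr_const card_ord.
- under eq_bigr => i _ do rewrite thetaXn hornerZ hornerXn E mulr1 natrM.
  by rewrite -mulr_sumr sum_nat_ord -addn1 natrD; field.
- under eq_bigr => i _ do
    rewrite thetaXn thetaZ thetaXn !hornerZ hornerXn E mulr1 natrM -expr2
            exprMn.
  by rewrite -mulr_sumr sum_sqr_ord -addn1 natrD; field.
Qed.

(** * Sums over roots of unity *)

Section RootSums.

Variables (F : numFieldType) (w : F) (e : nat).
Hypothesis prim_w : e.-primitive_root w.

Lemma prim_neq0 : w != 0.
Proof.
apply/eqP => w0; have := prim_expr_order prim_w.
rewrite w0 expr0n gtn_eqF ?(prim_order_gt0 prim_w) // => /esym/eqP.
by rewrite oner_eq0.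
Qed.

Lemma prim_neq1 (i : nat) : ~~ (e %| i)%N -> w ^+ i != 1.
Proof. by rewrite (prim_order_dvd prim_w). Qed.

Lemma prim_neq1_lt (i : nat) : (0 < i < e)%N -> w ^+ i != 1.
Proof.
move=> /andP[i0 ie]; apply: prim_neq1; apply/negP => /dvdn_leq -/(_ i0).
by rewrite leqNgt ie.
Qed.

Lemma geom_prod_prim :
  \sum_(i < e) 'X^i = \prod_(1 <= i < e) ('X - (w ^+ i)%:P).
Proof.
have e0 := prim_order_gt0 prim_w.
apply: (mulfI (_ : 'X - 1%:P != 0)); first by rewrite polyXsubC_eq0.
by rewrite polyC1 -subrX1 -(factor_Xn_sub_1 prim_w) big_ltn // expr0 polyC1.
Qed.

Lemma jet_XsubC (u : F) : u != 1 ->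
  jet 1 ('X - u%:P) (1 - u) (1 - u)^-1 (- (u / (u - 1) ^+ 2)).
Proof.
move=> u1; have nz : u - 1 != 0 by rewrite subr_eq0.
have nz' : 1 - u != 0 by rewrite subr_eq0 eq_sym.
have tE : theta ('X - u%:P) = 'X :> {poly F}.
  by rewrite !theta.unlock derivXsubC mulr1.
have tX : theta 'X = 'X :> {poly F} by rewrite !theta.unlock derivX mulr1.
by split; rewrite ?tE ?tX ?hornerXsubC ?hornerX //; field; rewrite ?nz ?nz'.
Qed.

(** Both sums are read off from the jet at 1 of 1 + q + ... + q^(e-1), computed once from its
    coefficients and once from its linear factors. *)
Lemma root_sums :
  \sum_(1 <= i < e) (1 - w ^+ i)^-1 = (e%:R - 1) / 2 /\
  \sum_(1 <= i < e) w ^+ i / (w ^+ i - 1) ^+ 2 = - (e%:R ^+ 2 - 1) / 12.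
Proof.
have e0 := prim_order_gt0 prim_w.
have J1 : jet 1 (\sum_(i < e) 'X^i) e%:R ((e%:R - 1) / 2 : F)
            ((e%:R ^+ 2 - 1) / 12).
  have := @jet_geom F 1 1 e.-1 (expr1n _ _).
  rewrite prednK //; under eq_bigr => i _ do rewrite mul1n.
  by rewrite expr1n !mul1r -subn1 natrB.
have J2 : jet 1 (\sum_(i < e) 'X^i) (\prod_(1 <= i < e) (1 - w ^+ i))
    (\sum_(1 <= i < e) (1 - w ^+ i)^-1)
    (\sum_(1 <= i < e) - (w ^+ i / (w ^+ i - 1) ^+ 2)).
  rewrite geom_prod_prim; apply: jet_prod => i.
  by rewrite mem_index_iota => /prim_neq1_lt/jet_XsubC.
have nz : e%:R != 0 :> F by rewrite pnatr_eq0 -lt0n.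
have [_ <- E] := jet_inj nz J1 J2; split=> //.
by rewrite mulNr E sumrN opprK.
Qed.

Lemma prim_expB (i : nat) : (i <= e)%N -> w ^+ (e - i) = (w ^+ i)^-1.
Proof.
move=> ie; apply: (mulIf (expf_neq0 i (prim_neq0))).
by rewrite mulVf ?expf_neq0 ?(prim_neq0) // -exprD subnK //
           prim_expr_order.
Qed.

Lemma root_sum1 :
  \sum_(1 <= i < e) w ^+ i / (w ^+ i - 1) = (e%:R - 1) / 2.
Proof.
have e0 := prim_order_gt0 prim_w.
have -> : \sum_(1 <= i < e) w ^+ i / (w ^+ i - 1)
          = \sum_(1 <= i < e) (1 - (1 - w ^+ i)^-1).
  rewrite big_seq [RHS]big_seq; apply: eq_bigr => i.
  rewrite mem_index_iota => /prim_neq1_lt; rewrite -subr_eq0 => nz.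
  have nz' : 1 - w ^+ i != 0 by rewrite -opprB oppr_eq0.
  by field; rewrite nz nz'.
rewrite sumrB (proj1 root_sums) sumr_const_nat natrB //.
by field.
Qed.

(* The summand without its factor [i] is invariant under [i -> e - i]. *)
Lemma root_sum_weighted :
  \sum_(1 <= i < e) i%:R * (w ^+ i / (w ^+ i - 1) ^+ 2)
  = - e%:R * (e%:R ^+ 2 - 1) / 24.
Proof.
set S := LHS.
have rev : S = \sum_(1 <= i < e) (e%:R - i%:R) * (w ^+ i / (w ^+ i - 1) ^+ 2).
  rewrite /S big_nat_rev big_seq [RHS]big_seq; apply: eq_bigr => i.
  rewrite mem_index_iota => /andP[i0 ie].
  have := @prim_neq1_lt i; rewrite i0 ie -subr_eq0 => /(_ isT) nz.
  have wi := expf_neq0 i (prim_neq0).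
  rewrite add1n subSS natrB ?prim_expB // 1?ltnW //; congr (_ * _).
  have nz' : 1 - w ^+ i != 0 by rewrite -opprB oppr_eq0.
  by move: (w ^+ i) nz nz' wi => u nz nz' wi; field; rewrite nz wi mulN1r.
have : S + S = e%:R * (- (e%:R ^+ 2 - 1) / 12).
  rewrite {2}rev -(proj2 root_sums) mulr_sumr -big_split.
  by apply: eq_bigr => i _ /=; ring.
move=> H; apply: (mulfI (_ : 2 != 0)); rewrite ?pnatr_eq0 //.
by rewrite mulr2n mulrDl !mul1r H; field.
Qed.

End RootSums.

(** * q-binomial coefficients at a root of unity *)

Section Block.

Variables (F : numFieldType) (w : F) (e : nat).
Hypothesis prim_w : e.-primitive_root w.

(* The j-th run of e consecutive factors of [qfactX F (e * N)], divided by
   X^e - 1 so that it does not vanish at w. *)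
Definition qblock (j : nat) : {poly F} :=
  (\sum_(i < j.+1) 'X^(e * i)) * \prod_(1 <= i < e) ('X^(e * j + i) - 1).

(** In each run of e consecutive factors only the last, q^(e(j+1)) - 1, vanishes at w, and q^e - 1
    splits off from it. *)
Lemma qfactX_muln (N : nat) :
  qfactX F (e * N) = ('X^e - 1) ^+ N * \prod_(j < N) qblock j.
Proof.
have e0 := prim_order_gt0 prim_w.
elim: N => [|N IHN]; first by rewrite muln0 /qfactX !big_ord0 mulr1.
rewrite mulnS addnC {1}/qfactX big_split_ord /= -/(qfactX F (e * N)) IHN.
rewrite big_ord_recr exprSr -!mulrA; congr (_ * _).
rewrite mulrCA; congr (_ * _).
rewrite /qblock mulrA.
have -> : ('X^e - 1) * \sum_(i < N.+1) 'X^(e * i)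
          = 'X^(e * N.+1) - 1 :> {poly F}.
  by under eq_bigr => i _ do rewrite exprM; rewrite -subrX1 -exprM.
(* A run is indexed from 0 here but from 1 in [qblock]; its last factor is the one just treated. *)
have split_last (f : nat -> {poly F}) :
    \prod_(i < e) f i = \prod_(1 <= i < e) f i.-1 * f e.-1.
  by rewrite big_add1 /= -(big_mkord xpredT) -[in LHS](prednK e0) big_nat_recr.
rewrite (split_last (fun i => 'X^((e * N + i).+1) - 1)) mulrC; congr (_ * _).
  by rewrite -addnS prednK // mulnS addnC.
rewrite big_seq [RHS]big_seq; apply: eq_bigr => i.
by rewrite mem_index_iota => /andP[i0 _]; rewrite -addnS prednK.
Qed.

(** These three constants are never evaluated: a product of N blocks contributes [gam ^+ N], [A * N]
    and [B * N], which cancel in the q-binomial because N = K + (N - K). *)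
Let gam : F := \prod_(1 <= i < e) (w ^+ i - 1).
Let A : F := \sum_(1 <= i < e) i%:R * (w ^+ i / (w ^+ i - 1)).
Let B : F := \sum_(1 <= i < e) i%:R ^+ 2 * (w ^+ i / (w ^+ i - 1) ^+ 2).

Lemma jet_qblock (j : nat) :
  jet w (qblock j) (j.+1%:R * gam) (e%:R ^+ 2 * j%:R / 2 + A)
    (e%:R ^+ 4 * (j%:R ^+ 2 + j%:R) / 12 + e%:R ^+ 2 * j%:R / 12 - B).
Proof.
have we := prim_expr_order prim_w.
have E i : w ^+ (e * j + i) = w ^+ i by rewrite exprD exprM we expr1n mul1r.
have JP : jet w (\prod_(1 <= i < e) ('X^(e * j + i) - 1)) gam
   (\sum_(1 <= i < e) (e * j + i)%:R * (w ^+ i / (w ^+ i - 1)))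
   (\sum_(1 <= i < e) - (e * j + i)%:R ^+ 2 * (w ^+ i / (w ^+ i - 1) ^+ 2)).
  apply: jet_prod => i; rewrite mem_index_iota => /(prim_neq1_lt prim_w) wi.
  by rewrite -E; apply: jet_Xnsub1; rewrite E.
have := jetM (jet_geom j we) JP; rewrite -/(qblock j).
have -> : \sum_(1 <= i < e) (e * j + i)%:R * (w ^+ i / (w ^+ i - 1))
   = e%:R * j%:R * ((e%:R - 1) / 2) + A.
  rewrite -(root_sum1 prim_w) mulr_sumr -big_split; apply: eq_bigr => i _ /=.
  by rewrite natrD natrM; ring.
(* Expanding (ej+i)^2 leaves sums weighted by 1, i and i^2: the first two are known root sums, the
   third is [B]. *)
have -> : \sum_(1 <= i < e) - (e * j + i)%:R ^+ 2 * (w ^+ i / (w ^+ i - 1) ^+ 2)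
   = - (e%:R * j%:R) ^+ 2 * (- (e%:R ^+ 2 - 1) / 12)
     - 2 * (e%:R * j%:R) * (- e%:R * (e%:R ^+ 2 - 1) / 24) - B.
  rewrite -(proj2 (root_sums prim_w)) -(root_sum_weighted prim_w) !mulr_sumr.
  rewrite -!sumrB; apply: eq_bigr => i _ /=.
  by rewrite natrD natrM; ring.
set u := _ + (_ + A); set v := _ + (_ - B).
have -> : u = e%:R ^+ 2 * j%:R / 2 + A by rewrite /u; field.
have -> : v = e%:R ^+ 4 * (j%:R ^+ 2 + j%:R) / 12 + e%:R ^+ 2 * j%:R / 12 - B.
  by rewrite /v -[j.+1%:R]natr1; field.
by [].
Qed.

Lemma jet_prod_qblock (N : nat) :
  jet w (\prod_(j < N) qblock j) (N`!%:R * gam ^+ N)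
    (e%:R ^+ 2 * N%:R * (N%:R - 1) / 4 + A * N%:R)
    (e%:R ^+ 4 * (N%:R ^+ 3 - N%:R) / 36 + e%:R ^+ 2 * N%:R * (N%:R - 1) / 24
     - B * N%:R).
Proof.
elim: N => [|N IHN].
  rewrite big_ord0 fact0 expr0 mul1r; have := jet1 w.
  by rewrite mulr0n !(mulr0, mul0r, expr0n, subrr, addr0).
rewrite big_ord_recr /=; have := jetM IHN (jet_qblock N).
rewrite factS natrM [gam ^+ N.+1]exprSr mulrACA [N`!%:R * _]mulrC.
set u := (X in jet _ _ _ X _ -> _); set v := (X in jet _ _ _ _ X -> _).
set u' := (X in _ -> jet _ _ _ X _); set v' := (X in _ -> jet _ _ _ _ X).
have -> : u = u' by rewrite /u /u' -[N.+1%:R]natr1; field.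
have -> : v = v' by rewrite /v /v' -[N.+1%:R]natr1; field.
by [].
Qed.

Lemma prod_sub1_neq0 : gam != 0.
Proof.
rewrite /gam big_seq; elim/big_ind: _ => [|a1 a2|i]; first exact: oner_neq0.
  exact: mulf_neq0.
by rewrite mem_index_iota subr_eq0 => /(prim_neq1_lt prim_w).
Qed.

(** The powers of q^e - 1 in numerator and denominator agree, so the q-binomial is a quotient of
    products of blocks, none of which vanishes at w. *)
Lemma jet_qbin_muln (N K : nat) :
  jet w (qbinF F (e * N) (e * K)) 'C(N, K)%:R
    (e%:R ^+ 2 * (K%:R * (N%:R - K%:R)) / 2)
    ((e%:R ^+ 4 * N%:R + e%:R ^+ 2) * (K%:R * (N%:R - K%:R)) / 12).
Proof.
have e0 := prim_order_gt0 prim_w.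
(* For K > N the q-binomial and the ordinary binomial are 0, and a jet with c = 0 holds for any u
   and v. *)
case: (leqP K N) => KN; last first.
  rewrite qbinF_gt ?ltn_mul2l ?e0 // bin_small //; exact: jet0.
set M := (N - K)%N.
have -> : N%:R - K%:R = M%:R :> F by rewrite natrB.
have NE : N = (K + M)%N by rewrite subnKC.
have cancelled : qbinF F (e * N) (e * K)
    * ((\prod_(j < K) qblock j) * (\prod_(j < M) qblock j))
    = \prod_(j < N) qblock j.
  apply: (mulfI (expf_neq0 N (Xnsub1_neq0 F e0))).
  rewrite -qfactX_muln -(@qbinF_mul F _ (e * K)) ?leq_mul2l ?KN ?orbT //.
  by rewrite -mulnBr !qfactX_muln {1}NE exprD /M; ring.
have J := jetM (jet_prod_qblock K) (jet_prod_qblock M).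
have nz : K`!%:R * gam ^+ K * (M`!%:R * gam ^+ M) != 0.
  by rewrite !mulf_neq0 ?expf_neq0 ?prod_sub1_neq0 ?pnatr_eq0 -?lt0n ?fact_gt0.
have := jet_prod_qblock N; rewrite -cancelled => /(jetM_inv nz J).
have -> : N`!%:R * gam ^+ N / (K`!%:R * gam ^+ K * (M`!%:R * gam ^+ M))
          = 'C(N, K)%:R.
  apply: (mulIf nz); rewrite divfK // -(bin_fact KN) !natrM -/M.
  by rewrite {2}NE exprD; ring.
set u := (X in jet _ _ _ X _ -> _); set v := (X in jet _ _ _ _ X -> _).
set u' := (X in _ -> jet _ _ _ X _); set v' := (X in _ -> jet _ _ _ _ X).
have -> : u = u' by rewrite /u /u' NE natrD; field.
have -> : v = v' by rewrite /v /v' NE natrD; field.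
by [].
Qed.

End Block.

(** * Values and simple zeros of q-binomials with other residues modulo e *)

Section RootValues.

Variables (F : numFieldType) (w : F) (e : nat).
Hypothesis prim_w : e.-primitive_root w.

Let e_gt0 : (0 < e)%N := prim_order_gt0 prim_w.

Lemma prim_expMD (N r : nat) : w ^+ (e * N + r) = w ^+ r.
Proof. by rewrite exprD exprM (prim_expr_order prim_w) expr1n mul1r. Qed.

Lemma horner_Xnsub1 (n : nat) : ('X^n - 1).[w] = w ^+ n - 1.
Proof. by rewrite hornerD hornerN hornerXn hornerC. Qed.

Lemma horner_theta_Xnsub1 (n : nat) :
  (theta ('X^n - 1)).[w] = n%:R * w ^+ n :> F.
Proof. by rewrite thetaD thetaXn -polyCN thetaC addr0 hornerZ hornerXn. Qed.

Lemma muln_predS (N : nat) : (e * N.+1 = (e * N + e.-1).+1)%N.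
Proof. by rewrite mulnS -addnS (prednK e_gt0) addnC. Qed.

(** In [qbinF_SS] the factor q^(eN) - 1 vanishes at w while q^l - 1 does not. *)
Lemma qbin_muln_vanish (N l : nat) :
  ~~ (e %| l)%N -> (qbinF F (e * N) l).[w] = 0.
Proof.
case: l => [|l]; first by rewrite dvdn0.
move=> /(prim_neq1 prim_w); rewrite -subr_eq0 => nz.
case: N => [|N]; first by rewrite muln0 qbinF_gt ?horner0.
apply: (mulIf nz); rewrite mul0r -horner_Xnsub1 -hornerM.
rewrite muln_predS qbinF_SS hornerM horner_Xnsub1 -addnS (prednK e_gt0).
by rewrite prim_expMD (prim_expr_order prim_w) subrr mul0r.
Qed.

(** Raising the upper index from eN + r to eN + r + 1 multiplies the value by (w^(r+1) - 1) /
    (w^(r+1) - 1) = 1. *)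
Lemma qbin_rem_muln (N K r : nat) :
  (r < e)%N -> (qbinF F (e * N + r) (e * K)).[w] = 'C(N, K)%:R.
Proof.
case: (leqP K N) => KN; last first.
  move=> re; rewrite bin_small // qbinF_gt ?horner0 //.
  by apply: leq_trans (leq_mul (leqnn e) KN); rewrite mulnS addnC ltn_add2r.
elim: r => [|r IHr] re.
  by rewrite addn0; case: (jet_qbin_muln prim_w N K).
have wr : w ^+ r.+1 != 1 by apply: (prim_neq1_lt prim_w).
have nz : w ^+ r.+1 - 1 != 0 by rewrite subr_eq0.
have := congr1 (horner^~ w) (qbinF_S F (e * N + r) (e * K)).
rewrite -addnS !hornerM !horner_Xnsub1 -addnBAC ?leq_mul2l ?KN ?orbT // -mulnBr.
by rewrite !prim_expMD mulrC => /(mulfI nz) ->; apply: IHr; apply: ltnW.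
Qed.

(** Raising the lower index from eK + s to eK + s + 1 multiplies the value by (w^(-s-1) - 1) /
    (w^(s+1) - 1) = - w^(-s-1); these factors accumulate to the sign and the binomial exponent. *)
Lemma qbin_pred_muln (N K s : nat) : (s < e)%N ->
  (qbinF F (e * N + e.-1) (e * K + s)).[w] * ((-1) ^+ s * w ^+ 'C(s.+1, 2))
  = 'C(N, K)%:R.
Proof.
case: (leqP K N) => KN; last first.
  move=> se; rewrite ['C(N, K)]bin_small // qbinF_gt ?horner0 ?mul0r //.
  have : (e * N + e <= e * K)%N by rewrite addnC -mulnS leq_mul2l KN orbT.
  by move: e_gt0; lia.
elim: s => [|s IHs] se.
  by rewrite addn0 ['C(1, 2)]bin_small // !expr0 !mulr1 qbin_rem_muln // prednK.
have ws : w ^+ s.+1 != 1 by apply: (prim_neq1_lt prim_w).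
have nz : w ^+ s.+1 - 1 != 0 by rewrite subr_eq0.
have nz' := expf_neq0 s.+1 (prim_neq0 prim_w).
have := congr1 (horner^~ w) (qbinF_Sr F (e * N + e.-1) (e * K + s)).
rewrite -addnS !hornerM !horner_Xnsub1.
have -> : (e * N + e.-1 - (e * K + s) = e * (N - K) + (e - s.+1))%N.
  by rewrite mulnBr; have := leq_mul (leqnn e) KN; lia.
rewrite !prim_expMD prim_expB // 1?ltnW //.
set b1 := (qbinF _ _ _).[w]; set b0 := (qbinF _ _ _).[w] => E.
rewrite -(IHs (ltnW se)) -/b0 binS bin1 exprD exprS.
have -> : b1 = - (b0 / w ^+ s.+1).
  by apply: (mulIf nz); rewrite E; field.
by field.
Qed.

(** Applying theta to [qbinF_SS] at w leaves only the derivative of q^(eN) - 1, which is eN; the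
    cofactor is given by [qbin_pred_muln] with N - 1. *)
Lemma theta_qbin_muln (N K s : nat) : (s.+1 < e)%N ->
  (theta (qbinF F (e * N) (e * K + s.+1))).[w]
    * ((-1) ^+ s * w ^+ 'C(s.+1, 2) * (w ^+ s.+1 - 1))
  = e%:R * ((N%:R - K%:R) * 'C(N, K)%:R).
Proof.
move=> se; case: N => [|N].
  rewrite muln0 qbinF_gt ?addnS // theta0 horner0 mul0r.
  by case: K => [|K]; rewrite ?subrr ?mul0r ?mulr0 // bin_small ?mulr0.
have eN := muln_predS N.
have ndvd : ~~ (e %| e * K + s.+1)%N.
  by rewrite (prim_order_dvd prim_w) prim_expMD; apply: (prim_neq1_lt prim_w).
have := congr1 (fun p => (theta p).[w]) (qbinF_SS F (e * N + e.-1) (e * K + s)).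
rewrite -eN -addnS !thetaM !hornerD !hornerM qbin_muln_vanish // mul0r addr0.
rewrite !horner_Xnsub1 horner_theta_Xnsub1 prim_expMD exprM.
rewrite (prim_expr_order prim_w) expr1n subrr mul0r addr0 mulr1.
set t := (theta _).[w] => E.
have := qbin_pred_muln N K (ltnW se).
set b := (qbinF _ _ _).[w] in E * => bE.
have binE : N.+1%:R * 'C(N, K)%:R = (N.+1%:R - K%:R) * 'C(N.+1, K)%:R :> F.
  case: (leqP K N.+1) => KN.
    by rewrite -natrB // -!natrM mul_bin_down.
  by rewrite !bin_small ?mulr0 // ltnW.
rewrite -binE -bE.
transitivity (t * (w ^+ s.+1 - 1) * ((-1) ^+ s * w ^+ 'C(s.+1, 2))).
  by ring.
by rewrite E natrM; ring.
Qed.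

(* The exponent r^2 of q comes from the terms y^2 + z^2 of f. *)
Lemma theta_qbin_mul (N1 N2 K r : nat) : (0 < r < e)%N ->
  (theta (qbinF F (e * N1) (e * K + r))).[w]
    * (theta (qbinF F (e * N2) (e * K + r))).[w] * w ^+ (r ^ 2)
  = e%:R ^+ 2 * ((N1%:R - K%:R) * (N2%:R - K%:R)
      * ('C(N1, K)%:R * 'C(N2, K)%:R)) * (w ^+ r / (w ^+ r - 1) ^+ 2).
Proof.
case: r => // s /= se.
have ws : w ^+ s.+1 != 1 by apply: (prim_neq1_lt prim_w).
have nz : w ^+ s.+1 - 1 != 0 by rewrite subr_eq0.
have := theta_qbin_muln N1 K se; have := theta_qbin_muln N2 K se.
set t1 := (theta _).[w]; set t2 := (theta _).[w] => E1 E2.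
(* The signs square to 1 and twice ['C(s.+1, 2)] is s(s+1), so the exponent (s+1)^2 exceeds it by
   s+1, which yields the numerator w^r. *)
have -> : w ^+ (s.+1 ^ 2) = (((-1) ^+ s * w ^+ 'C(s.+1, 2)) ^+ 2) * w ^+ s.+1.
  rewrite exprMn -exprM mulnC exprM sqrrN expr1n expr1n mul1r -exprM -exprD.
  congr (_ ^+ _); have := mul_bin_diag s.+1 1; rewrite bin1 /=.
  by move: 'C(_, _) => c; lia.
apply: (mulIf (expf_neq0 2 nz)).
transitivity (t1 * ((-1) ^+ s * w ^+ 'C(s.+1, 2) * (w ^+ s.+1 - 1))
            * (t2 * ((-1) ^+ s * w ^+ 'C(s.+1, 2) * (w ^+ s.+1 - 1)))
            * w ^+ s.+1); first by ring.
by rewrite E1 E2; field.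
Qed.

End RootValues.

(** * Values of a_n and its derivatives *)

Lemma sum_ord_muln (V : nmodType) (e N : nat) (g : nat -> V) :
  \sum_(i < e * N) g i = \sum_(j < N) \sum_(r < e) g (e * j + r)%N.
Proof.
elim: N => [|N IHN]; first by rewrite muln0 !big_ord0.
by rewrite mulnS addnC big_split_ord /= IHN [RHS]big_ord_recr.
Qed.

Lemma sum_ord_widen0 (V : nmodType) (n m : nat) (g : nat -> V) :
  (n <= m)%N -> (forall i, (n <= i)%N -> g i = 0) ->
  \sum_(i < n) g i = \sum_(i < m) g i.
Proof.
move=> nm g0; rewrite (big_ord_widen m g nm) big_mkcond.
by apply: eq_bigr => i _; case: ltnP => // /g0 ->.
Qed.

Lemma sum_ord_head (V : nmodType) (n : nat) (g : nat -> V) :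
  (0 < n)%N -> \sum_(i < n) g i = g 0%N + \sum_(1 <= i < n) g i.
Proof. by move=> n0; rewrite -(big_mkord xpredT) big_ltn. Qed.

(* Stated over an abstract algebra: evaluating these polynomials by rewriting
   directly in {mpoly S[3]} makes unification unfold the multinomials. *)
Section MorphEval.

Variables (S : comNzRingType) (T : comAlgType S) (phi : T -> S).
Implicit Types x y z p q : T.
Hypotheses (phiD : forall p q, phi (p + q) = phi p + phi q)
  (phiN : forall p, phi (- p) = - phi p)
  (phiZ : forall (c : S) p, phi (c *: p) = c * phi p)
  (phiX : forall p i, phi (p ^+ i) = phi p ^+ i)
  (phiM : forall p q, phi (p * q) = phi p * phi q).

Let phiE := (phiD, phiN, phiZ, phiX, phiM).

Lemma morph_f (A B C D : S) x y z :
  phi (y ^+ 2 + z ^+ 2 + A *: x ^+ 2 + B *: (x * y) + C *: (x * z)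
       + D *: (y * z))
  = phi y ^+ 2 + phi z ^+ 2 + A * phi x ^+ 2 + B * (phi x * phi y)
    + C * (phi x * phi z) + D * (phi y * phi z).
Proof. by rewrite !phiE. Qed.

Lemma morph_L (c : S) x y z p :
  phi (x * z - y ^+ 2 - z ^+ 2 + c *: (3 *: (x * y) + y * z - x ^+ 2) + p)
  = phi x * phi z - phi y ^+ 2 - phi z ^+ 2
    + c * (3 * (phi x * phi y) + phi y * phi z - phi x ^+ 2) + phi p.
Proof. by rewrite !phiE. Qed.

Lemma morph_Q1 (c d : S) x y z p :
  phi (p ^+ 2
    + c *: (x ^+ 2 * y - x * y ^+ 2 + 2 *: (x * y * z) + y ^+ 2 * z
            - y * z ^+ 2)
    + d *: (- x ^+ 2 + x * y - y ^+ 2 - z ^+ 2 + z * y + z * x))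
  = phi p ^+ 2
    + c * (phi x ^+ 2 * phi y - phi x * phi y ^+ 2
           + 2 * (phi x * phi y * phi z) + phi y ^+ 2 * phi z
           - phi y * phi z ^+ 2)
    + d * (- phi x ^+ 2 + phi x * phi y - phi y ^+ 2 - phi z ^+ 2
           + phi z * phi y + phi z * phi x).
Proof. by rewrite !phiE. Qed.

Lemma morph_Q2 (c : S) x y z p :
  phi (c *: (7 *: x ^+ 2 - 17 *: (x * y) + 12 *: y ^+ 2 - 12 *: (x * z)
             - 7 *: (z * y) + 12 *: z ^+ 2) - p)
  = c * (7 * phi x ^+ 2 - 17 * (phi x * phi y) + 12 * phi y ^+ 2
         - 12 * (phi x * phi z) - 7 * (phi z * phi y) + 12 * phi z ^+ 2)
    - phi p.
Proof. by rewrite !phiE. Qed.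

End MorphEval.

Section Eval3.

Variables (S : comNzRingType) (n k l : nat).
Let ev (P : {mpoly S[3]}) : S := eval3 P n k l.

Let evD P Q : ev (P + Q) = ev P + ev Q.
Proof. exact: mevalD. Qed.

Let evN P : ev (- P) = - ev P.
Proof. exact: mevalN. Qed.

Let evZ c P : ev (c *: P) = c * ev P.
Proof. exact: mevalZ. Qed.

Let evX P i : ev (P ^+ i) = ev P ^+ i.
Proof. exact: rmorphXn. Qed.

Let evM P Q : ev (P * Q) = ev P * ev Q.
Proof. exact: mevalM. Qed.

Let ev_x : ev x = n%:R.
Proof. by rewrite /ev /eval3 /x mevalXU (tnth_nth 0). Qed.

Let ev_y : ev y = k%:R.
Proof. by rewrite /ev /eval3 /y mevalXU (tnth_nth 0). Qed.

Let ev_z : ev z = l%:R.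
Proof. by rewrite /ev /eval3 /z mevalXU (tnth_nth 0). Qed.

Lemma eval3_f (A B C D : S) :
  eval3 (y ^+ 2 + z ^+ 2 + A *: x ^+ 2 + B *: (x * y) + C *: (x * z)
         + D *: (y * z)) n k l
  = k%:R ^+ 2 + l%:R ^+ 2 + A * n%:R ^+ 2 + B * (n%:R * k%:R)
    + C * (n%:R * l%:R) + D * (k%:R * l%:R).
Proof.
by rewrite -ev_x -ev_y -ev_z; apply: (morph_f evD evZ evX evM).
Qed.

Lemma eval3_L_shape (c : S) (p : {mpoly S[3]}) :
  eval3 (x * z - y ^+ 2 - z ^+ 2 + c *: (3 *: (x * y) + y * z - x ^+ 2) + p)
    n k l
  = n%:R * l%:R - k%:R ^+ 2 - l%:R ^+ 2
    + c * (3 * (n%:R * k%:R) + k%:R * l%:R - n%:R ^+ 2) + eval3 p n k l.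
Proof.
by rewrite -ev_x -ev_y -ev_z; apply: (morph_L evD evN evZ evX evM).
Qed.

Lemma eval3_Q1_shape (c d : S) (p : {mpoly S[3]}) :
  eval3 (p ^+ 2
    + c *: (x ^+ 2 * y - x * y ^+ 2 + 2 *: (x * y * z) + y ^+ 2 * z
            - y * z ^+ 2)
    + d *: (- x ^+ 2 + x * y - y ^+ 2 - z ^+ 2 + z * y + z * x)) n k l
  = eval3 p n k l ^+ 2
    + c * (n%:R ^+ 2 * k%:R - n%:R * k%:R ^+ 2
           + 2 * (n%:R * k%:R * l%:R) + k%:R ^+ 2 * l%:R
           - k%:R * l%:R ^+ 2)
    + d * (- n%:R ^+ 2 + n%:R * k%:R - k%:R ^+ 2 - l%:R ^+ 2
           + l%:R * k%:R + l%:R * n%:R).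
Proof.
by rewrite -ev_x -ev_y -ev_z; apply: (morph_Q1 evD evN evZ evX evM).
Qed.

Lemma eval3_Q2_shape (c : S) (p : {mpoly S[3]}) :
  eval3 (c *: (7 *: x ^+ 2 - 17 *: (x * y) + 12 *: y ^+ 2 - 12 *: (x * z)
             - 7 *: (z * y) + 12 *: z ^+ 2) - p) n k l
  = c * (7 * n%:R ^+ 2 - 17 * (n%:R * k%:R) + 12 * k%:R ^+ 2
         - 12 * (n%:R * l%:R) - 7 * (l%:R * k%:R) + 12 * l%:R ^+ 2)
    - eval3 p n k l.
Proof.
by rewrite -ev_x -ev_y -ev_z; apply: (morph_Q2 evD evN evZ evX evM).
Qed.

End Eval3.

Lemma fpolyE (A B C D : int) (n k l : nat) :
  eval3 (fpoly A B C D) n k l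
  = k%:R ^+ 2 + l%:R ^+ 2 + A * n%:R ^+ 2 + B * (n%:R * k%:R)
    + C * (n%:R * l%:R) + D * (k%:R * l%:R).
Proof.
exact: eval3_f.
Qed.

(** The cofactor t may be negative, so the computation runs in integer powers of the unit w;
    nonnegativity of m removes the absolute value. *)
Lemma expr_absz_mod (F : fieldType) (w : F) (e r : nat) (m t : int) :
  e.-primitive_root w -> 0 <= m -> m = r%:Z + e%:Z * t -> w ^+ `|m|%N = w ^+ r.
Proof.
move=> prim_w m0 mE.
have w0 : w != 0.
  by rewrite -unitfE -(unitrX_pos _ (prim_order_gt0 prim_w))
             (prim_expr_order prim_w) unitr1.
rewrite -[LHS]/(w ^ (`|m|%N)%:Z) (gez0_abs m0) mE expfzDr //.
rewrite -exprz_exp.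
have -> : w ^ e%:Z = 1 := prim_expr_order prim_w.
by rewrite exp1rz mulr1.
Qed.

Lemma sum_ord_cross (V : nmodType) (n : nat) (h : nat -> nat -> V) :
  (0 < n)%N ->
  (forall r s, (0 < r < n)%N -> (0 < s < n)%N -> h r s = 0) ->
  \sum_(r < n) \sum_(s < n) h r s
  = h 0%N 0%N + \sum_(1 <= r < n) h r 0%N + \sum_(1 <= s < n) h 0%N s.
Proof.
move=> n0 h0; rewrite (sum_ord_head (fun r => \sum_(s < n) h r s)) //.
rewrite (sum_ord_head (h 0%N)) // addrAC; congr (_ + _ + _).
rewrite big_seq [RHS]big_seq; apply: eq_bigr => r.
rewrite mem_index_iota => re; rewrite (sum_ord_head (h r)) //.
rewrite big_seq big1 ?addr0 // => s; rewrite mem_index_iota; exact: h0.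
Qed.

(** * Second-order data of a_n at a root of unity *)

Section RootJets.

Variables (F : numFieldType) (A B C D : int).
Let f := fpoly A B C D.
Hypothesis f_ge0 : forall n k l : nat, 0 <= eval3 f n k l.

Variables (w : F) (e : nat).
Hypothesis prim_w : e.-primitive_root w.
Let e_gt0 : (0 < e)%N := prim_order_gt0 prim_w.

Definition aterm (n k l : nat) : {poly F} :=
  qbinF F n k ^+ 2 * qbinF F n l * qbinF F k l * qbinF F (k + l) n
  * 'X^(`|eval3 f n k l|%N).

Lemma map_a (n M : nat) : (n < M)%N ->
  map_poly intr (a f n) = \sum_(k < M) \sum_(l < M) aterm n k l.
Proof.
move=> nM; have term0 k l : (n < k)%N || (n < l)%N -> aterm n k l = 0.
  by rewrite /aterm => /orP[] h;
     rewrite (qbinF_gt F h) ?expr0n ?mul0r ?mulr0 ?mul0r.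
rewrite /a rmorph_sum /=.
rewrite -(@sum_ord_widen0 _ n.+1 M (fun k => \sum_(l < M) aterm n k l)) //;
  last first.
  by move=> k nk; rewrite big1 // => l _; rewrite term0 // nk.
apply: eq_bigr => k _; rewrite rmorph_sum /=.
rewrite -(@sum_ord_widen0 _ n.+1 M (fun l => aterm n k l)) //; last first.
  by move=> l nl; rewrite term0 // nl orbT.
rewrite big_mkcond; apply: eq_bigr => l _.
case: ifP => [_|]; first by rewrite !rmorphM !rmorphXn /= map_polyX.
move/negbT; rewrite negb_and -!ltnNge /aterm => /orP[] h.
  by rewrite [qbinF F k l]qbinF_gt // mulr0 !mul0r.
by rewrite [qbinF F (k + l) n]qbinF_gt // mulr0 !mul0r.
Qed.

Definition binprod (N K K' : nat) : F :=
  'C(N, K)%:R ^+ 2 * 'C(N, K')%:R * 'C(K, K')%:R * 'C(K + K', N)%:R.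

(** The logarithmic derivative of a summand divided by e^2, as it comes out, with one contribution
    per q-binomial and one from the power of q; [eval3_L] identifies it with L. *)
Definition Lval (N K K' : nat) : F :=
  let x := N%:R in let y := K%:R in let z := K'%:R in
  (2 * (y * (x - y)) + z * (x - z) + z * (y - z) + x * (y + z - x)) / 2
  + (eval3 f N K K')%:~R.

(** The second entry of the jet of the same summand; the power of q contributes 0 to it. *)
Definition Vval (N K K' : nat) : F :=
  let x := N%:R in let y := K%:R in let z := K'%:R in let E := e%:R in
  (2 * (E ^+ 4 * x + E ^+ 2) * (y * (x - y))
   + (E ^+ 4 * x + E ^+ 2) * (z * (x - z))
   + (E ^+ 4 * y + E ^+ 2) * (z * (y - z))
   + (E ^+ 4 * (y + z) + E ^+ 2) * (x * (y + z - x))) / 12.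

Lemma intr_fval (n k l : nat) :
  (`|eval3 f n k l|%N)%:R = (eval3 f n k l)%:~R :> F.
Proof. by rewrite natr_absz ger0_norm. Qed.

Lemma expr_fval (N K K' r s : nat) : (r * s = 0)%N ->
  w ^+ `|eval3 f (e * N) (e * K + r) (e * K' + s)|%N = w ^+ (r ^ 2 + s ^ 2).
Proof.
(* The witness is the quotient by e of f - r^2 - s^2 - Drs, and Drs is 0 by assumption. *)
move=> rs; apply: (expr_absz_mod
  (t := e%:Z * (K%:Z ^+ 2 + K'%:Z ^+ 2) + 2 * (K%:Z * r%:Z)
  + 2 * (K'%:Z * s%:Z) + A * e%:Z * N%:Z ^+ 2 + B * N%:Z * (e%:Z * K%:Z + r%:Z)
  + C * N%:Z * (e%:Z * K'%:Z + s%:Z)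
  + D * (e%:Z * K%:Z * K'%:Z + K%:Z * s%:Z + K'%:Z * r%:Z)) prim_w) => //.
have rs' : r%:Z * s%:Z = 0 by rewrite -PoszM rs.
rewrite fpolyE !natrD !natrM !natz PoszD -!mulnn !PoszM.
transitivity (r%:Z * r%:Z + s%:Z * s%:Z + D * (r%:Z * s%:Z) +
 e%:Z * (e%:Z * (K%:Z ^+ 2 + K'%:Z ^+ 2) + 2 * (K%:Z * r%:Z)
  + 2 * (K'%:Z * s%:Z) + A * e%:Z * N%:Z ^+ 2 + B * N%:Z * (e%:Z * K%:Z + r%:Z)
  + C * N%:Z * (e%:Z * K'%:Z + s%:Z)
  + D * (e%:Z * K%:Z * K'%:Z + K%:Z * s%:Z + K'%:Z * r%:Z))).
  by ring.
by rewrite rs' mulr0 addr0.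
Qed.

Lemma jet_aterm_muln (N K K' : nat) :
  jet w (aterm (e * N) (e * K) (e * K')) (binprod N K K')
    (e%:R ^+ 2 * Lval N K K') (Vval N K K').
Proof.
have JX := jetXn w `|eval3 f (e * N) (e * K) (e * K')|.
have wX : w ^+ `|eval3 f (e * N) (e * K) (e * K')| = 1.
  by have := @expr_fval N K K' 0 0 erefl; rewrite !addn0.
have J1 := jet_qbin_muln prim_w N K.
have J := jetM (jetM (jetM (jetM (jetM J1 J1) (jet_qbin_muln prim_w N K'))
  (jet_qbin_muln prim_w K K')) (jet_qbin_muln prim_w (K + K') N)) JX.
move: J; rewrite mulnDr wX mulr1 -!expr2 -/(aterm _ _ _) -/(binprod N K K').
rewrite intr_fval.
(* f is a homogeneous quadratic form. *)
have -> : (eval3 f (e * N) (e * K) (e * K'))%:~R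
          = e%:R ^+ 2 * (eval3 f N K K')%:~R :> F.
  rewrite !fpolyE !natrM !(rmorphD, rmorphM, rmorphXn) /= !natz -!pmulrn.
  by ring.
set u := (X in jet _ _ _ X _ -> _); set v := (X in jet _ _ _ _ X -> _).
set u' := (X in _ -> jet _ _ _ X _); set v' := (X in _ -> jet _ _ _ _ X).
have -> : u = u' by rewrite /u /u' /Lval natrD; field.
have -> : v = v' by rewrite /v /v' /Vval natrD; field.
by [].
Qed.

(** The double zero comes from the squared q-binomial [n choose k]. The other factors have lower
    index divisible by e and take ordinary binomial values. *)
Lemma aterm_k_ndvd (N K K' r : nat) : (0 < r < e)%N ->
  let p := aterm (e * N) (e * K + r) (e * K') in
  [/\ p.[w] = 0, (theta p).[w] = 0 &
      (theta (theta p)).[w]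
      = 2 * e%:R ^+ 2 * (N%:R - K%:R) ^+ 2 * binprod N K K'
        * (w ^+ r / (w ^+ r - 1) ^+ 2)].
Proof.
move=> re p; have /andP[r0 re'] := re.
have b0 : (qbinF F (e * N) (e * K + r)).[w] = 0.
  apply: qbin_muln_vanish => //.
  by rewrite (prim_order_dvd prim_w) prim_expMD // (prim_neq1_lt prim_w).
pose rest : {poly F} := qbinF F (e * N) (e * K') * qbinF F (e * K + r) (e * K')
  * qbinF F (e * (K + K') + r) (e * N)
  * 'X^(`|eval3 f (e * N) (e * K + r) (e * K')|%N).
have -> : p = qbinF F (e * N) (e * K + r) * qbinF F (e * N) (e * K + r) * rest.
  by rewrite /rest /p /aterm addnAC -mulnDr expr2 !mulrA.
have [-> -> ->] := theta_sqr_zero rest b0 b0.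
split=> //; rewrite /rest !hornerM hornerXn.
rewrite !(qbin_rem_muln prim_w) //; have [-> _ _] := jet_qbin_muln prim_w N K'.
have -> : w ^+ `|eval3 f (e * N) (e * K + r) (e * K')| = w ^+ (r ^ 2).
  by have := @expr_fval N K K' r 0 (muln0 r); rewrite !addn0.
have := theta_qbin_mul prim_w N N K re.
set T := (theta _).[w]; move: (w ^+ _) (w ^+ r / _) => W Q E.
transitivity (2 * (T * T * W)
  * ('C(N, K')%:R * 'C(K, K')%:R * 'C(K + K', N)%:R)).
  by ring.
by rewrite E /binprod; ring.
Qed.

(** Here the two simple zeros come from [n choose l] and [k choose l]. *)
Lemma aterm_l_ndvd (N K K' s : nat) : (0 < s < e)%N ->
  let p := aterm (e * N) (e * K) (e * K' + s) in
  [/\ p.[w] = 0, (theta p).[w] = 0 &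
      (theta (theta p)).[w]
      = 2 * e%:R ^+ 2 * ((N%:R - K'%:R) * (K%:R - K'%:R)) * binprod N K K'
        * (w ^+ s / (w ^+ s - 1) ^+ 2)].
Proof.
move=> se p; have /andP[s0 se'] := se.
have b0 M : (qbinF F (e * M) (e * K' + s)).[w] = 0.
  apply: qbin_muln_vanish => //.
  by rewrite (prim_order_dvd prim_w) prim_expMD // (prim_neq1_lt prim_w).
pose rest : {poly F} := qbinF F (e * N) (e * K) ^+ 2
  * qbinF F (e * (K + K') + s) (e * N)
  * 'X^(`|eval3 f (e * N) (e * K) (e * K' + s)|%N).
have -> : p = qbinF F (e * N) (e * K' + s) * qbinF F (e * K) (e * K' + s) * rest.
  have swap (p1 p2 p3 p4 p5 : {poly F}) :
    p1 * p2 * p3 * p4 * p5 = p2 * p3 * (p1 * p4 * p5) by ring.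
  by rewrite /rest /p /aterm addnA -mulnDr swap.
have [-> -> ->] := theta_sqr_zero rest (b0 N) (b0 K).
split=> //; rewrite /rest !hornerM !horner_exp hornerX.
rewrite (qbin_rem_muln prim_w _ _ se').
have [-> _ _] := jet_qbin_muln prim_w N K.
have -> : w ^+ `|eval3 f (e * N) (e * K) (e * K' + s)| = w ^+ (s ^ 2).
  by have := @expr_fval N K K' 0 s (mul0n s); rewrite !addn0 add0n.
have := theta_qbin_mul prim_w N K K' se.
set T1 := (theta _).[w]; set T2 := (theta _).[w].
move: (w ^+ _) (w ^+ s / _) => W Q E.
transitivity (2 * (T1 * T2 * W) * ('C(N, K)%:R ^+ 2 * 'C(K + K', N)%:R)).
  by ring.
by rewrite E /binprod; ring.
Qed.

(** The square of [n choose k] gives a double zero, and [n choose l] a further one. *)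
Lemma aterm_kl_ndvd (N K K' r s : nat) : (0 < r < e)%N -> (0 < s < e)%N ->
  let p := aterm (e * N) (e * K + r) (e * K' + s) in
  [/\ p.[w] = 0, (theta p).[w] = 0 & (theta (theta p)).[w] = 0].
Proof.
move=> re se p.
have b0 M i : (0 < i < e)%N -> (qbinF F (e * N) (e * M + i)).[w] = 0.
  move=> ie; apply: qbin_muln_vanish => //.
  by rewrite (prim_order_dvd prim_w) prim_expMD // (prim_neq1_lt prim_w).
pose rest : {poly F} :=
  qbinF F (e * N) (e * K' + s) * qbinF F (e * K + r) (e * K' + s)
  * qbinF F (e * K + r + (e * K' + s)) (e * N)
  * 'X^(`|eval3 f (e * N) (e * K + r) (e * K' + s)|%N).
have -> : p = qbinF F (e * N) (e * K + r) * qbinF F (e * N) (e * K + r) * rest.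
  by rewrite /rest /p /aterm expr2 !mulrA.
have [-> -> ->] := theta_sqr_zero rest (b0 K r re) (b0 K r re).
by split=> //; rewrite /rest !hornerM (b0 K' s se) !mul0r mulr0.
Qed.

Lemma aterm_block (N K K' : nat) :
  let p := \sum_(r < e) \sum_(s < e) aterm (e * N) (e * K + r) (e * K' + s) in
  [/\ p.[w] = binprod N K K',
      (theta p).[w] = e%:R ^+ 2 * (binprod N K K' * Lval N K K') &
      (theta (theta p)).[w] = binprod N K K' * (e%:R ^+ 4 * Lval N K K' ^+ 2
        + Vval N K K'
        - e%:R ^+ 2 * (e%:R ^+ 2 - 1) / 6 * ((N%:R - K%:R) ^+ 2
            + (N%:R - K'%:R) * (K%:R - K'%:R)))].
Proof.
pose h r s := aterm (e * N) (e * K + r) (e * K' + s).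
have h00 : h 0%N 0%N = aterm (e * N) (e * K) (e * K') by rewrite /h !addn0.
have hr0 r : h r 0%N = aterm (e * N) (e * K + r) (e * K') by rewrite /h addn0.
have h0s s : h 0%N s = aterm (e * N) (e * K) (e * K' + s) by rewrite /h addn0.
have sumE (phi : {poly F} -> F) :
    (forall r s, (0 < r < e)%N -> (0 < s < e)%N -> phi (h r s) = 0) ->
    \sum_(r < e) \sum_(s < e) phi (h r s)
    = phi (aterm (e * N) (e * K) (e * K'))
      + \sum_(1 <= r < e) phi (aterm (e * N) (e * K + r) (e * K'))
      + \sum_(1 <= s < e) phi (aterm (e * N) (e * K) (e * K' + s)).
  move=> /(sum_ord_cross (h := fun r s => phi (h r s)) e_gt0) ->.
  by rewrite h00; congr (_ + _ + _); apply: eq_bigr => i _; rewrite ?hr0 ?h0s.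
have [J0 J1 J2] := jet_aterm_muln N K K'.
move=> p; rewrite /p; split.
- rewrite horner_sum; under eq_bigr => r _ do rewrite horner_sum.
  rewrite (sumE (horner^~ w)) => [|r s re se]; last first.
    by case: (aterm_kl_ndvd N K K' re se).
  rewrite J0 big_seq big1 => [|r]; last first.
    by rewrite mem_index_iota => /(aterm_k_ndvd N K K')[].
  rewrite big_seq big1 => [|r]; last first.
    by rewrite mem_index_iota => /(aterm_l_ndvd N K K')[].
  by rewrite !addr0.
- rewrite theta_sum horner_sum.
  under eq_bigr => r _ do rewrite theta_sum horner_sum.
  rewrite (sumE (fun p => (theta p).[w])) => [|r s re se]; last first.
    by case: (aterm_kl_ndvd N K K' re se).
  rewrite J1 big_seq big1 => [|r]; last first.
    by rewrite mem_index_iota => /(aterm_k_ndvd N K K')[].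
  rewrite big_seq big1 => [|r]; last first.
    by rewrite mem_index_iota => /(aterm_l_ndvd N K K')[].
  by rewrite !addr0; ring.
- rewrite !theta_sum horner_sum.
  under eq_bigr => r _ do rewrite !theta_sum horner_sum.
  rewrite (sumE (fun p => (theta (theta p)).[w])) => [|r s re se]; last first.
    by case: (aterm_kl_ndvd N K K' re se).
  (* As r runs over the nonzero residues, the sum of w^r / (w^r - 1)^2 is the constant -(e^2 - 1)/12
     of [root_sums]. *)
  have -> : \sum_(1 <= r < e)
      (theta (theta (aterm (e * N) (e * K + r) (e * K')))).[w]
    = 2 * e%:R ^+ 2 * (N%:R - K%:R) ^+ 2 * binprod N K K'
      * (- (e%:R ^+ 2 - 1) / 12).
    rewrite -(proj2 (root_sums prim_w)) mulr_sumr big_seq [RHS]big_seq.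
    apply: eq_bigr => r; rewrite mem_index_iota.
    by move=> /(aterm_k_ndvd N K K')[_ _ ->].
  have -> : \sum_(1 <= s < e)
      (theta (theta (aterm (e * N) (e * K) (e * K' + s)))).[w]
    = 2 * e%:R ^+ 2 * ((N%:R - K'%:R) * (K%:R - K'%:R)) * binprod N K K'
      * (- (e%:R ^+ 2 - 1) / 12).
    rewrite -(proj2 (root_sums prim_w)) mulr_sumr big_seq [RHS]big_seq.
    apply: eq_bigr => s; rewrite mem_index_iota.
    by move=> /(aterm_l_ndvd N K K')[_ _ ->].
  by rewrite J2; field.
Qed.

Lemma a_jet (N : nat) :
  let p := map_poly intr (a f (e * N)) in
  [/\ p.[w] = \sum_(K < N.+1) \sum_(K' < N.+1) binprod N K K',
      (theta p).[w] = \sum_(K < N.+1) \sum_(K' < N.+1)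
        e%:R ^+ 2 * (binprod N K K' * Lval N K K') &
      (theta (theta p)).[w] = \sum_(K < N.+1) \sum_(K' < N.+1)
        binprod N K K' * (e%:R ^+ 4 * Lval N K K' ^+ 2
        + Vval N K K'
        - e%:R ^+ 2 * (e%:R ^+ 2 - 1) / 6 * ((N%:R - K%:R) ^+ 2
            + (N%:R - K'%:R) * (K%:R - K'%:R)))].
Proof.
(* The range is extended to e(N+1), where the surplus terms vanish, so that it splits into N+1
   complete residue blocks. *)
have eN : (e * N < e * N.+1)%N by rewrite ltn_mul2l e_gt0 leqnn.
have -> : map_poly intr (a f (e * N)) = \sum_(K < N.+1) \sum_(K' < N.+1)
    \sum_(r < e) \sum_(s < e) aterm (e * N) (e * K + r) (e * K' + s).
  rewrite (map_a eN).
  rewrite (sum_ord_muln e N.+1 (fun k => \sum_(l < e * N.+1) aterm (e * N) k l)).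
  apply: eq_bigr => K _; rewrite [RHS]exchange_big; apply: eq_bigr => r _ /=.
  by rewrite (sum_ord_muln e N.+1 (aterm (e * N) (e * K + r))).
split; rewrite ?theta_sum ?horner_sum; apply: eq_bigr => K _;
  rewrite ?theta_sum ?horner_sum; apply: eq_bigr => K' _;
  by have [] := aterm_block N K K'.
Qed.

End RootJets.

(** * Complex roots of unity and the formulas in terms of L, Q1 and Q2 *)

Section ComplexRoots.

Variable R : realType.

Lemma natr_bin_prod (N K K' : nat) :
  ('C(N, K) ^ 2 * 'C(N, K') * 'C(K, K') * 'C(K + K', N))%:R
  = binprod R[i] N K K'.
Proof. by rewrite /binprod !natrM. Qed.

Lemma Complex_expr (t : R) (j : nat) :
  Complex (trigo.cos t) (trigo.sin t) ^+ j
  = Complex (trigo.cos (t *+ j)) (trigo.sin (t *+ j)).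
Proof.
elim: j => [|j IHj]; first by rewrite mulr0n trigo.cos0 trigo.sin0.
rewrite exprS IHj mulrS trigo.cosD trigo.sinD.
by rewrite /GRing.mul /= addrC [X in Complex _ X]addrC; congr Complex; ring.
Qed.

Lemma omega_expr (n j : nat) :
  omega R n ^+ j = Complex (trigo.cos (2 * trigo.pi / n%:R *+ j))
                           (trigo.sin (2 * trigo.pi / n%:R *+ j)).
Proof. exact: Complex_expr. Qed.

Lemma omega_prim (n : nat) : (0 < n)%N -> n.-primitive_root (omega R n).
Proof.
move=> n0; have nz : n%:R != 0 :> R by rewrite pnatr_eq0 -lt0n.
have full : omega R n ^+ n = 1.
  rewrite omega_expr -mulr_natr divfK // mulr_natl.
  by rewrite trigo.cos2pi trigo.sin2pi.
apply/andP; split=> //; apply/forallP => i; apply/eqP.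
rewrite unity_rootE; have [->|ni] := eqVneq i.+1 n; first by rewrite full eqxx.
apply/negP => /eqP; rewrite omega_expr.
(* Halving the angle turns cos(2t) = 1 into sin t = 0, impossible for 0 < t < pi. *)
pose t : R := trigo.pi / n%:R *+ i.+1.
have -> : 2 * trigo.pi / n%:R *+ i.+1 = t *+ 2.
  by rewrite /t -mulrA mulr_natl mulrnAC.
case; rewrite trigo.cos_mulr2n trigo.cos2sin2 => Ec _.
have ti : 0 < t < trigo.pi.
  rewrite /t -mulr_natr; apply/andP; split.
    by rewrite !mulr_gt0 ?trigo.pi_gt0 ?invr_gt0 ?ltr0n.
  rewrite -mulrA gtr_pMr ?trigo.pi_gt0 // mulrC ltr_pdivrMr ?ltr0n // mul1r.
  by rewrite ltr_nat ltn_neqAle ni ltn_ord.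
have := trigo.sin_gt0_pi ti => s0.
have : trigo.sin t ^+ 2 = 0 by lra.
by move/eqP; rewrite expf_eq0 /= gt_eqF.
Qed.

Variables (A B C D : int).
Let f := fpoly A B C D.
Hypothesis f_ge0 : forall n k l : nat, 0 <= eval3 f n k l.

Lemma eval3_fC (n k l : nat) : eval3 (fC R f) n k l = (eval3 f n k l)%:~R.
Proof.
have -> : fC R f = y ^+ 2 + z ^+ 2 + A%:~R *: x ^+ 2 + B%:~R *: (x * y)
    + C%:~R *: (x * z) + D%:~R *: (y * z).
  rewrite /fC /f /fpoly; set phi := map_mpoly _.
  have X i : phi 'X_i = 'X_i by rewrite /phi map_mpolyX.
  have Z c p : phi (c *: p) = c%:~R *: phi p by rewrite /phi map_mpolyZ.
  have XX p q : phi (p * q) = phi p * phi q by exact: rmorphM.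
  have DD p q : phi (p + q) = phi p + phi q by exact: rmorphD.
  by rewrite !expr2 !(DD, Z, XX) /x /y /z !X.
by rewrite eval3_f /f fpolyE !(rmorphD, rmorphM, rmorphXn) /= !natz -!pmulrn.
Qed.

Lemma eval3_L (N K K' : nat) : eval3 (L R f) N K K' = Lval R[i] A B C D N K K'.
Proof.
by rewrite eval3_L_shape eval3_fC /Lval -/f; field.
Qed.

Lemma eval3_Q1 (N K K' : nat) :
  let n := N%:R in let k := K%:R in let l := K'%:R in
  eval3 (Q1 R f) N K K' = Lval R[i] A B C D N K K' ^+ 2
    + (n ^+ 2 * k - n * k ^+ 2 + 2 * (n * k * l) + k ^+ 2 * l - k * l ^+ 2) / 12
    + (- n ^+ 2 + n * k - k ^+ 2 - l ^+ 2 + l * k + l * n) / 6.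
Proof.
by move=> n k l; rewrite eval3_Q1_shape eval3_L; field.
Qed.

Lemma eval3_Q2 (N K K' : nat) :
  let n := N%:R in let k := K%:R in let l := K'%:R in
  eval3 (Q2 R f) N K K' =
    (7 * n ^+ 2 - 17 * (n * k) + 12 * k ^+ 2 - 12 * (n * l) - 7 * (l * k)
     + 12 * l ^+ 2) / 12 - (eval3 f N K K')%:~R.
Proof.
by move=> n k l; rewrite eval3_Q2_shape eval3_fC; field.
Qed.

Lemma aP_binprod (N : nat) (P : {mpoly R[i][3]}) :
  aP N P
  = \sum_(K < N.+1) \sum_(K' < N.+1) binprod R[i] N K K' * eval3 P N K K'.
Proof.
by apply: eq_bigr => K _; apply: eq_bigr => K' _; rewrite natr_bin_prod.
Qed.

Lemma prim_root1 : 1.-primitive_root (1 : R[i]).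
Proof.
rewrite /primitive_root_of_unity; apply/forallP => -[[|//] ?].
by rewrite unity_rootE expr1 !eqxx.
Qed.

(** This is [a_jet] for e = 1, since 1 is a primitive first root of unity. *)
Lemma a_at_1 (N : nat) : (toC R (a f N)).[1]
  = \sum_(K < N.+1) \sum_(K' < N.+1) binprod R[i] N K K'.
Proof. by have [] := a_jet f_ge0 prim_root1 N; rewrite mul1n. Qed.

Lemma a_values (w : R[i]) (e N : nat) : e.-primitive_root w ->
  [/\ (toC R (a f (e * N))).[w] = (toC R (a f N)).[1],
      w * (toC R (a f (e * N)))^`().[w] = e%:R ^+ 2 * aP N (L R f) &
      w ^+ 2 * (toC R (a f (e * N)))^`(2).[w]
      = e%:R ^+ 4 * aP N (Q1 R f) + e%:R ^+ 2 * aP N (Q2 R f)].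
Proof.
move=> prim_w; have [V0 V1 V2] := a_jet f_ge0 prim_w N; split.
- by rewrite a_at_1 -V0.
- rewrite -horner_theta V1 aP_binprod mulr_sumr; apply: eq_bigr => K _.
  by rewrite mulr_sumr; apply: eq_bigr => K' _; rewrite eval3_L.
(* At w, theta^2 p equals w^2 p'' + w p', so w p' is added to both sides. What remains is a
   polynomial identity between Q1, Q2 and L, checked summand by summand. *)
- apply: (addIr (w * (toC R (a f (e * N)))^`().[w])).
  rewrite -horner_theta2 V2 -horner_theta V1 !aP_binprod !mulr_sumr -!big_split.
  apply: eq_bigr => K _; rewrite !mulr_sumr -!big_split.
  apply: eq_bigr => K' _ /=.
  rewrite eval3_Q1 eval3_Q2 /Vval /Lval -/f.
  move: (binprod _ _ _ _) (_%:~R) N%:R K%:R K'%:R e%:R => b c n k l E.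
  by field.
Qed.

End ComplexRoots.

(** * Moebius inversion *)

Lemma perm_primes_mul (p d : nat) :
  prime p -> (0 < d)%N -> ~~ (p %| d)%N ->
  perm_eq (primes (p * d)) (p :: primes d).
Proof.
move=> pp d0 pd; apply: uniq_perm; rewrite ?primes_uniq //=.
  by rewrite mem_primes (negbTE pd) !andbF primes_uniq.
move=> q; rewrite (primesM _ (prime_gt0 pp) d0) (primes_prime pp).
by rewrite mem_seq1 in_cons.
Qed.

(** If p divides d then p^2 divides pd; otherwise pd has exactly one more prime factor than d. *)
Lemma mobius_mul_prime (p d : nat) : prime p -> (0 < d)%N ->
  mobius (p * d) = if (p %| d)%N then 0 else - mobius d.
Proof.
move=> pp d0; have p0 := prime_gt0 pp; rewrite /mobius.
case: (boolP (p %| d)%N) => pd.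
  case: allP => // sqf; have := sqf p.
  rewrite mem_primes pp muln_gt0 p0 d0 dvdn_mulr // => /(_ isT).
  rewrite lognM // (logn_prime p pp) eqxx add1n eqSS => /eqP E.
  have : (0 < logn p d)%N by rewrite logn_gt0 mem_primes pp d0.
  by rewrite E.
have pE := perm_primes_mul pp d0 pd.
rewrite (perm_all _ pE) (perm_size pE) /= lognM // (logn_prime p pp) eqxx.
have -> : logn p d = 0%N.
  apply/eqP; rewrite -leqn0 leqNgt logn_gt0 mem_primes.
  by rewrite (negbTE pd) !andbF.
have -> : all (fun q => logn q (p * d) == 1%N) (primes d)
          = all (fun q => logn q d == 1%N) (primes d).
  apply: eq_in_all => q; rewrite mem_primes => /and3P[pq _ qd].
  rewrite lognM // (logn_prime q pp).
  by case: (q =P p) => // pqE; rewrite -pqE qd in pd.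
by case: all; rewrite ?oppr0 // exprS mulN1r.
Qed.

Lemma sum_divisors_dvd (V : nmodType) (p n : nat) (g : nat -> V) :
  (0 < p)%N -> (0 < n)%N -> (p %| n)%N ->
  \sum_(d <- divisors n | (p %| d)%N) g d
  = \sum_(c <- divisors (n %/ p)) g (p * c)%N.
Proof.
move=> p0 n0 pn; rewrite -big_filter -[RHS](big_map (muln p) xpredT g).
have q0 : (0 < n %/ p)%N by rewrite divn_gt0 // dvdn_leq.
apply: perm_big; apply: uniq_perm.
- by rewrite filter_uniq ?divisors_uniq.
- rewrite map_inj_uniq ?divisors_uniq // => i j /eqP.
  by rewrite eqn_pmul2l // => /eqP.
move=> d; rewrite mem_filter -dvdn_divisors //; apply/andP/mapP.
  move=> [/dvdnP[c ->] cn]; exists c; rewrite 1?mulnC // -dvdn_divisors //.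
  by rewrite -(dvdn_pmul2r p0) divnK.
move=> [c]; rewrite -dvdn_divisors // => cn ->; rewrite dvdn_mulr //.
by rewrite mulnC -(divnK pn) dvdn_pmul2r.
Qed.

(** For a prime p dividing n, the divisors pc with p not dividing c cancel the divisors prime to p,
    since n and n/p have the same divisors prime to p. *)
Lemma sum_mobius (n : nat) : (0 < n)%N ->
  \sum_(d <- divisors n) mobius d = (n == 1%N)%:R.
Proof.
move=> n0; case: eqVneq => [->|n1]; first by rewrite big_seq1.
have pp : prime (pdiv n) by rewrite pdiv_prime //; lia.
have pn := pdiv_dvd n; move: (pdiv n) pp pn => p pp pn.
have p0 := prime_gt0 pp.
have q0 : (0 < n %/ p)%N by rewrite divn_gt0 // dvdn_leq.
rewrite (bigID (fun d => p %| d)%N) /= sum_divisors_dvd //.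
have -> : \sum_(c <- divisors (n %/ p)) mobius (p * c)
          = \sum_(c <- divisors (n %/ p) | ~~ (p %| c)%N) - mobius c.
  rewrite [RHS]big_mkcond big_seq [RHS]big_seq; apply: eq_bigr => c.
  rewrite -dvdn_divisors // => cn; rewrite mobius_mul_prime //.
    by case: (p %| c)%N.
  by case: c cn => //; rewrite dvd0n; lia.
rewrite sumrN -[X in - X]big_filter -[X in _ + X]big_filter.
rewrite (perm_big [seq d <- divisors n | ~~ (p %| d)%N]) ?addNr //=.
apply: uniq_perm; rewrite ?filter_uniq ?divisors_uniq // => d.
rewrite !mem_filter -!dvdn_divisors //; case: (boolP (p %| d)%N) => //= pd.
have cpd : coprime d p by rewrite coprime_sym prime_coprime.
by rewrite -[in RHS](divnK pn) Gauss_dvdl.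
Qed.

(** After exchanging the sums, the coefficient of g(e) is the sum of mobius over the divisors of
    n/e, which vanishes unless e = n. *)
Lemma mobius_inversion (V : comPzRingType) (g : nat -> V) (n : nat) :
  (0 < n)%N ->
  \sum_(d <- divisors n) \sum_(e <- divisors d) (mobius (d %/ e))%:~R * g e
  = g n.
Proof.
move=> n0.
have -> : \sum_(d <- divisors n)
      \sum_(e <- divisors d) (mobius (d %/ e))%:~R * g e
  = \sum_(d <- divisors n) \sum_(e <- divisors n | (e %| d)%N)
      (mobius (d %/ e))%:~R * g e.
  rewrite big_seq [RHS]big_seq; apply: eq_bigr => d.
  rewrite -dvdn_divisors // => dn; have d0 := dvdn_gt0 n0 dn.
  rewrite -[RHS]big_filter; apply: perm_big; apply: uniq_perm.
  - exact: divisors_uniq.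
  - by rewrite filter_uniq ?divisors_uniq.
  move=> e; rewrite mem_filter -!dvdn_divisors // andb_idr // => ed.
  exact: dvdn_trans ed dn.
rewrite (exchange_big_dep xpredT) //=.
have inner e : e \in divisors n ->
  \sum_(d <- divisors n | (e %| d)%N) (mobius (d %/ e))%:~R * g e
  = if e == n then g n else 0.
  rewrite -dvdn_divisors // => en; have e0 := dvdn_gt0 n0 en.
  rewrite sum_divisors_dvd //.
  under eq_bigr => c _ do rewrite mulKn //.
  have q0 : (0 < n %/ e)%N by rewrite divn_gt0 // dvdn_leq.
  have intr_sum (s : seq nat) :
    \sum_(c <- s) (mobius c)%:~R = (\sum_(c <- s) mobius c)%:~R :> V.
    by rewrite rmorph_sum.
  rewrite -mulr_suml intr_sum (sum_mobius q0).
  have -> : (n %/ e == 1)%N = (e == n).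
    by rewrite -(eqn_pmul2r e0) divnK // mul1n eq_sym.
  by case: eqP => [->|_]; rewrite ?mul1r ?mul0r.
rewrite big_seq (eq_bigr _ inner) -big_seq -big_mkcond /=.
rewrite -big_filter (perm_big [:: n]) ?big_seq1 //=.
apply: uniq_perm; rewrite ?filter_uniq ?divisors_uniq // => e.
rewrite mem_filter inE andb_idr // => /eqP ->; exact: divisors_id.
Qed.

(** * Digits and interpolation *)

(** Repeated division by [n]_q stays over the integers because [n]_q is monic; it terminates because
    n > 1 makes the degree drop. *)
Lemma int_digits (n : nat) (p : {poly int}) : (1 < n)%N ->
  exists s : seq {poly int},
    (forall i, (size (s`_i)%R < n)%N)
    /\ p = \sum_(i < size s) s`_i * qint n ^+ i.
Proof.
move=> n1; have n0 : (0 < n)%N by apply: ltnW.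
have mon := qint_monic n0.
have [m] := ubnP (size p); elim: m p => // m IHm p pm.
case: (leqP n (size p)) => np; last first.
  exists [:: p]; split; last by rewrite big_ord1 expr0 mulr1.
  by case=> [|i] //=; rewrite nth_nil size_poly0.
have [s [s_size s_sum]] : exists s : seq {poly int},
    (forall i, (size (s`_i)%R < n)%N)
    /\ p %/ qint n = \sum_(i < size s) s`_i * qint n ^+ i.
  apply: IHm; rewrite size_divp ?monic_neq0 // size_qint.
  by move: pm np n1; move: (size p) => sz; lia.
exists (p %% qint n :: s); split.
  case=> [|i] //=; have := ltn_modp p (qint n).
  by rewrite size_qint monic_neq0.
rewrite big_ord_recl /= expr0 mulr1 {1}(Pdiv.IdomainMonic.divp_eq mon p) addrC.
congr (_ + _); rewrite s_sum mulr_suml; apply: eq_bigr => i _.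
by rewrite exprSr mulrA.
Qed.

Section Interpolation.

Variables (F : fieldType) (w : F) (n : nat).
Hypothesis prim_w : n.-primitive_root w.

(** The difference has degree below n-1 and n-1 distinct roots. *)
Lemma poly_eq_roots (p q : {poly F}) : (size p < n)%N -> (size q < n)%N ->
  (forall j, (0 < j < n)%N -> p.[w ^+ j] = q.[w ^+ j]) -> p = q.
Proof.
move=> sp sq pq; apply/eqP; rewrite -subr_eq0; apply/negPn/negP => nz.
have := @max_poly_roots _ _ [seq w ^+ j | j <- index_iota 1 n] nz.
have -> : all (root (p - q)) [seq w ^+ j | j <- index_iota 1 n].
  apply/allP => v /mapP[j]; rewrite mem_index_iota => jn ->.
  by rewrite rootE hornerD hornerN pq // subrr.
have -> : uniq [seq w ^+ j | j <- index_iota 1 n].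
  rewrite map_inj_in_uniq ?iota_uniq // => i j; rewrite !mem_index_iota.
  move=> /andP[_ i_n] /andP[_ j_n] /eqP; rewrite (eq_prim_root_expr prim_w).
  by rewrite !modn_small // => /eqP.
rewrite size_map size_iota => /(_ isT isT); rewrite ltnNge; apply/negP/negPn.
apply: leq_trans (size_polyD _ _) _; rewrite size_polyN geq_max.
by move: (size p) (size q) sp sq => k l; lia.
Qed.

End Interpolation.

Lemma size_coprime6_dvd (n d : nat) :
  (0 < n)%N -> coprime n 6 -> (d %| n)%N -> d != n -> (5 <= n %/ d)%N.
Proof.
move=> n0 cn dn dneq; have := divnK dn; set q := (n %/ d)%N => qE.
have cq : coprime q 6 by apply: coprime_dvdl cn; rewrite -qE dvdn_mulr.
case: q cq qE => [|[|[|[|[|q]]]]] //.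
by rewrite mul1n => _ E; rewrite E eqxx in dneq.
Qed.

(** * Values and degrees of the polynomials G *)

Section GPoly.

Variable R : realType.

Lemma toC_qint (n : nat) : toC R (qint n) = \sum_(i < n) 'X^i.
Proof.
rewrite qint_sum /toC rmorph_sum; apply: eq_bigr => i _.
by rewrite /= map_polyXn.
Qed.

Lemma toC_qint_mul (n : nat) : ('X - 1) * toC R (qint n) = 'X^n - 1.
Proof. by rewrite toC_qint -subrX1. Qed.

Lemma qint_quotient (n d : nat) : (0 < n)%N -> (d %| n)%N ->
  toC R (qint n) %/ toC R (qint (n %/ d)) = \sum_(i < d) 'X^((n %/ d) * i).
Proof.
move=> n0 dn; have d0 := dvdn_gt0 n0 dn.
have q0 : (0 < n %/ d)%N by rewrite divn_gt0 // dvdn_leq.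
set q := (n %/ d)%N in q0 *.
have nz : toC R (qint q) != 0.
  apply/eqP => E; have := toC_qint_mul q; rewrite E mulr0 => /esym/eqP.
  by apply/negP; rewrite Xnsub1_neq0.
have -> : toC R (qint n) = (\sum_(i < d) 'X^(q * i)) * toC R (qint q).
  apply: (mulfI (_ : 'X - 1 != 0)); first by rewrite -polyC1 polyXsubC_eq0.
  rewrite mulrCA !toC_qint_mul mulrC.
  under eq_bigr => i _ do rewrite exprM.
  by rewrite -subrX1 -exprM /q divnK.
by rewrite mulpK.
Qed.

(** At w^j the quotient [n]_q / [n/d]_q is d if d divides j and 0 otherwise. The Moebius sum over
    the divisors of gcd(j,n) remains; d = n is not among them since n does not divide j. *)
Lemma horner_G (g : nat -> R[i]) (w : R[i]) (n j : nat) :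
  (0 < n)%N -> n.-primitive_root w -> ~~ (n %| j)%N ->
  (G g n).[w ^+ j] = g (gcdn j n).
Proof.
move=> n0 prim_w nj.
rewrite -[RHS](@mobius_inversion _ g) ?gcdn_gt0 ?n0 ?orbT //.
rewrite /G horner_sum.
have -> : \sum_(d <- divisors (gcdn j n))
      \sum_(e <- divisors d) (mobius (d %/ e))%:~R * g e
  = \sum_(d <- divisors n | (d != n) && (d %| j)%N)
      \sum_(e <- divisors d) (mobius (d %/ e))%:~R * g e.
  rewrite -[RHS]big_filter; apply: perm_big; apply: uniq_perm.
  - exact: divisors_uniq.
  - by rewrite filter_uniq ?divisors_uniq.
  move=> d; rewrite mem_filter -!dvdn_divisors ?gcdn_gt0 ?n0 ?orbT // dvdn_gcd.
  case: eqVneq => [->|] /=; first by rewrite (negbTE nj).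
  by [].
rewrite big_mkcondr big_seq_cond [RHS]big_seq_cond; apply: eq_bigr => d.
rewrite -dvdn_divisors // => /andP[dn _].
rewrite hornerZ qint_quotient // horner_sum; have d0 := dvdn_gt0 n0 dn.
have dnz : d%:R != 0 :> R[i] by rewrite pnatr_eq0 -lt0n.
have q0 : (0 < n %/ d)%N by rewrite divn_gt0 // dvdn_leq.
move: (\sum_(e <- divisors d) _) => c.
under eq_bigr => i _ do rewrite hornerXn -exprM mulnA exprM.
case: ifPn => dj.
  have -> : w ^+ (j * (n %/ d)) = 1.
    apply/eqP; rewrite -(prim_order_dvd prim_w) -{1}(divnK dn) mulnC.
    by rewrite dvdn_pmul2r.
  under eq_bigr => i _ do rewrite expr1n.
  by rewrite sumr_const card_ord mulrC; field.
have nz : w ^+ (j * (n %/ d)) - 1 != 0.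
  rewrite subr_eq0 -(prim_order_dvd prim_w) -{1}(divnK dn) mulnC.
  by rewrite dvdn_pmul2r.
rewrite (_ : \sum_(i < d) _ = 0) ?mulr0 //; apply: (mulfI nz).
rewrite -subrX1 mulr0 -exprM -mulnA divnK // mulnC exprM.
by rewrite (prim_expr_order prim_w) expr1n subrr.
Qed.

(** The exponents are at most (n/d)(d-1) = n - n/d <= n - 5. *)
Lemma size_G (g : nat -> R[i]) (n : nat) :
  (0 < n)%N -> coprime n 6 -> (size (G g n) <= n - 4)%N.
Proof.
move=> n0 cn; apply: leq_trans (size_sum _ _ _) _.
rewrite big_seq_cond; elim/big_ind: _ => // [s1 s2|d].
  by rewrite geq_max => -> ->.
rewrite -dvdn_divisors // => /andP[dn dneq].
apply: leq_trans (size_scale_leq _ _) _; rewrite qint_quotient //.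
have q5 := size_coprime6_dvd n0 cn dn dneq.
apply: leq_trans (size_sum _ _ _) _; elim/big_ind: _ => // [s1 s2|i _].
  by rewrite geq_max => -> ->.
rewrite size_polyXn; have := ltn_ord i; have := divnK dn.
set q := (n %/ d)%N in q5 * => <- id.
have : (q * i + q <= d * q)%N by rewrite -mulnSr mulnC leq_mul2r id orbT.
by lia.
Qed.

End GPoly.

Lemma derivn2 (S : nzRingType) (p : {poly S}) : p^`(2) = p^`()^`().
Proof. by []. Qed.

(** At a zero of Q, the i-th derivative involves only the digits up to index i, so the digits can be
    solved for one after the other. *)
Lemma horner_digits (F : comNzRingType) (v : F) (f0 f1 f2 r Q : {poly F}) :
  Q.[v] = 0 ->
  let p := f0 + f1 * Q + f2 * Q ^+ 2 + r * Q ^+ 3 in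
  [/\ p.[v] = f0.[v], p^`().[v] = f0^`().[v] + f1.[v] * Q^`().[v] &
      p^`(2).[v] = f0^`(2).[v] + 2 * f1^`().[v] * Q^`().[v]
        + f1.[v] * Q^`(2).[v] + 2 * f2.[v] * Q^`().[v] ^+ 2].
Proof.
move=> Q0 p; rewrite /p !derivn2 !exprS expr0 !(derivD, derivM, derivC).
by split; rewrite !(hornerD, hornerM, hornerC) Q0; ring.
Qed.

Section QintRoot.

Variables (F : fieldType) (n : nat) (v : F) (Q : {poly F}).
Hypotheses (n0 : (0 < n)%N) (vn : v ^+ n = 1) (v1 : v != 1).
Hypothesis QE : ('X - 1) * Q = 'X^n - 1.

(** Differentiating (X - 1) Q = X^n - 1 once and twice gives, at a nontrivial n-th root of unity,
    linear equations for Q' and Q''. *)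
Let Q_deriv : Q + ('X - 1) * Q^`() = 'X^(n.-1) *+ n.
Proof.
have := congr1 (@deriv F) QE.
rewrite derivM !derivD !derivN derivX -polyC1 derivC derivXn.
by rewrite oppr0 !addr0 mul1r.
Qed.

Let Q_deriv2 : 2 *: Q^`() + ('X - 1) * Q^`(2) = 'X^(n.-2) *+ n.-1 *+ n.
Proof.
have := congr1 (@deriv F) Q_deriv.
rewrite derivD derivM derivD derivN derivX -polyC1 derivC derivMn derivXn.
by rewrite oppr0 addr0 mul1r addrA scaler_nat mulr2n.
Qed.

Lemma qint_root : Q.[v] = 0.
Proof.
have := congr1 (horner^~ v) QE.
rewrite hornerM !hornerD !hornerN hornerX hornerXn hornerC vn subrr.
by move/eqP; rewrite mulf_eq0 subr_eq0 (negbTE v1) => /eqP.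
Qed.

Lemma qint_root_deriv : v * (v - 1) * Q^`().[v] = n%:R.
Proof.
have := congr1 (horner^~ v) Q_deriv.
rewrite hornerD hornerM hornerD hornerN hornerX hornerC hornerMn hornerXn.
rewrite qint_root add0r => E.
by rewrite -mulrA E mulrnAr -exprS prednK // vn.
Qed.

Lemma qint_root_deriv2 :
  v ^+ 2 * (2 * Q^`().[v] + (v - 1) * Q^`(2).[v]) = n%:R * (n%:R - 1).
Proof.
have := congr1 (horner^~ v) Q_deriv2.
rewrite hornerD hornerZ hornerM hornerD hornerN hornerX hornerC !hornerMn.
rewrite hornerXn => ->.
(* For n = 1 both sides are 0; otherwise v^2 v^(n-2) = 1. *)
case: n n0 vn => // -[|k] _ vk.
  by rewrite mulr0n mul0rn mulr0 subrr mulr0.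
have -> : k.+2%:R - 1 = k.+1%:R :> F by rewrite -[k.+2%:R]natr1 addrK.
by rewrite -natrM !mulrnAr -exprD add2n vk -mulrnA mulnC.
Qed.

End QintRoot.

(** At v = w^j, Q vanishes with Q'(v) = n / (v(v-1)), so p, p' and p'' at v determine f0, f1 and f2
    there. The closed forms have size below n and agree with the digits at these n-1 points. *)
Lemma digits_interpolation (F : numFieldType) (n : nat) (w : F)
  (Q p f0 f1 f2 r G0 G1 G2 : {poly F}) :
  (5 <= n)%N -> n.-primitive_root w -> ('X - 1) * Q = 'X^n - 1 ->
  p = f0 + f1 * Q + f2 * Q ^+ 2 + r * Q ^+ 3 ->
  (size f0 < n)%N -> (size f1 < n)%N -> (size f2 < n)%N ->
  (size G0 <= n - 4)%N -> (size G1 <= n - 4)%N -> (size G2 <= n - 4)%N ->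
  (forall j, (0 < j < n)%N -> let v := w ^+ j in
     [/\ G0.[v] = p.[v], G1.[v] = p^`().[v] * v &
         G2.[v] = p^`(2).[v] * v ^+ 2]) ->
  [/\ f0 = G0,
      f1 = n%:R^-1 *: (('X - 1) * (G1 - 'X * G0^`())) &
      f2 = (2 * n%:R ^+ 2)^-1 *:
        (('X - 1) ^+ 2 *
         (G2 + G0^`(2) * 'X^2
          + (n%:R - 1) *: ('X * G0^`() - G1)
          + 2 *: ('X * (G0^`() - G1^`()))))].
Proof.
move=> n5 prim_w QE pE s0 s1 s2 sG0 sG1 sG2 val.
have n0 : (0 < n)%N by apply: leq_trans n5.
have nz : n%:R != 0 :> F by rewrite pnatr_eq0 -lt0n.
have root j : (0 < j < n)%N ->
    [/\ (w ^+ j) ^+ n = 1, w ^+ j != 1 & w ^+ j != 0].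
  move=> jn; split; last by rewrite expf_neq0 // (prim_neq0 prim_w).
    by rewrite -exprM mulnC exprM (prim_expr_order prim_w) expr1n.
  exact: (prim_neq1_lt prim_w).
have E0 : f0 = G0.
  apply: (poly_eq_roots prim_w) => //.
    by move: (size G0) sG0 n5 => s; lia.
  move=> j jn; have [vn v1 _] := root j jn; have [-> _ _] := val j jn.
  have [e0 _ _] := horner_digits f0 f1 f2 r (qint_root vn v1 QE).
  by rewrite pE e0.
have sizeX (q : {poly F}) m : (size q <= m)%N -> (size ('X * q)%R <= m.+1)%N.
  by move=> sq; apply: leq_trans (size_polyMleq _ _) _; rewrite size_polyX.
have sizeX1 (q : {poly F}) m :
    (size q <= m)%N -> (size (('X - 1) * q)%R <= m.+1)%N.
  move=> sq; apply: leq_trans (size_polyMleq _ _) _.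
  by rewrite -polyC1 size_XsubC.
have sizeD (q q' : {poly F}) m :
    (size q <= m)%N -> (size q' <= m)%N -> (size (q + q')%R <= m)%N.
  by move=> sq sq'; apply: leq_trans (size_polyD _ _) _; rewrite geq_max sq.
have sizeN (q : {poly F}) m : (size q <= m)%N -> (size (- q)%R <= m)%N.
  by rewrite size_polyN.
have sizeZ c (q : {poly F}) m : (size q <= m)%N -> (size (c *: q)%R <= m)%N.
  by apply: leq_trans; apply: size_scale_leq.
have size' (q : {poly F}) m : (size q <= m)%N -> (size q^`() <= m.-1)%N.
  move=> sq; case: (eqVneq q 0) => [->|q0]; first by rewrite deriv0 size_poly0.
  by have := lt_size_deriv q0; move: (size _) (size q) sq => k l; lia.
have n5E : (n - 4).-1.+1 = (n - 4)%N by lia.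
have sX (q : {poly F}) :
    (size q <= n - 4)%N -> (size ('X * q^`())%R <= n - 4)%N.
  by move=> sq; rewrite -n5E; apply/sizeX; apply/size'.
have E1 : f1 = n%:R^-1 *: (('X - 1) * (G1 - 'X * G0^`())).
  apply: (poly_eq_roots prim_w) => //.
    apply: (@leq_ltn_trans (n - 4).+1); last by lia.
    by apply/sizeZ/sizeX1/sizeD => //; apply/sizeN/sX.
  move=> j jn; have [vn v1 v0] := root j jn; have [_ g1 _] := val j jn.
  have rQ := qint_root vn v1 QE; have d1 := qint_root_deriv n0 vn v1 QE.
  have [_ e1 _] := horner_digits f0 f1 f2 r rQ; rewrite -pE E0 in e1.
  rewrite hornerZ hornerM !hornerD !hornerN hornerM hornerX hornerC g1 e1.
  move: (w ^+ j) v1 v0 d1 => v; rewrite -subr_eq0 => v1 v0 d1.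
  have q0 : Q^`().[v] != 0.
    by apply: contraNneq nz => q0; rewrite -d1 q0 mulr0.
  by rewrite -d1; field; rewrite v0 v1 q0.
split=> //; apply: (poly_eq_roots prim_w) => //.
  apply: (@leq_ltn_trans (n - 3).+2); last by lia.
  (* The bound n-3 is for X^2 G0'': at n = 5 the truncated predecessors give size at most 2 instead
     of n-4 = 1. The factor (X - 1)^2 then still fits below n. *)
  have le43 : (n - 4 <= n - 3)%N by lia.
  rewrite exprS expr1 -mulrA; apply/sizeZ/sizeX1/sizeX1.
  apply/sizeD; last apply/sizeZ.
    apply/sizeD; last first.
      by apply/sizeZ/(leq_trans _ le43)/sizeD; [exact: sX | exact: sizeN].
    apply/sizeD; first exact: leq_trans le43.
    apply: leq_trans (size_polyMleq _ _) _; rewrite size_polyXn addn3 /=.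
    apply: (@leq_trans (n - 4).-2.+2); last by lia.
    by rewrite !ltnS; apply/size'/size'.
  apply: (leq_trans _ le43); rewrite -n5E; apply/sizeX/sizeD; last apply/sizeN.
    exact: size'.
  exact: size'.
move=> j jn; have [vn v1 v0] := root j jn; have [_ g1 g2] := val j jn.
have rQ := qint_root vn v1 QE; have d1 := qint_root_deriv n0 vn v1 QE.
have d2 := qint_root_deriv2 n0 vn QE.
have [_ _ e2] := horner_digits f0 f1 f2 r rQ; rewrite -pE E0 E1 in e2.
move: e2; rewrite derivZ derivM !derivD !derivN derivM derivX -polyC1 derivC.
rewrite oppr0 addr0 mul1r.
rewrite !(hornerD, hornerN, hornerZ, hornerM, hornerX, hornerC).
rewrite g2 => ->.
move: (w ^+ j) v1 v0 d1 d2 => v; rewrite -subr_eq0 => v1 v0 d1 d2.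
have -> : Q^`(2).[v]
    = (n%:R * (n%:R - 1) / v ^+ 2 - 2 * Q^`().[v]) / (v - 1).
  by rewrite -d2; field; rewrite v0 v1.
have -> : Q^`().[v] = n%:R / (v * (v - 1)) by rewrite -d1; field; rewrite v0 v1.
by field; rewrite nz v0 v1.
Qed.

Lemma horner_poly_tail (S : nzRingType) (s : seq {poly S}) (Q : {poly S}) :
  \sum_(i < size s) s`_i * Q ^+ i
  = s`_0 + s`_1 * Q + s`_2 * Q ^+ 2
    + (\sum_(i < size s) s`_(3 + i) * Q ^+ i) * Q ^+ 3.
Proof.
(* Padding with zero digits makes three leading terms available however short s is. *)
rewrite (@sum_ord_widen0 _ _ (3 + size s) (fun i => s`_i * Q ^+ i));
  rewrite ?leq_addl //.
  rewrite big_split_ord /= !big_ord_recl big_ord0 /= expr0 expr1 mulr1 addr0.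
  rewrite !addrA; congr (_ + _); rewrite mulr_suml; apply: eq_bigr => i _.
  by rewrite -mulrA -exprD addnC.
by move=> i si; rewrite nth_default // mul0r.
Qed.

Lemma size_toC (R : realType) (p : {poly int}) : size (toC R p) = size p.
Proof. by apply: size_map_inj_poly => //; apply: intr_inj. Qed.

Lemma nth_toC (R : realType) (s : seq {poly int}) (i : nat) :
  (map (toC R) s)`_i = toC R s`_i.
Proof.
case: (ltnP i (size s)) => si; first by rewrite (nth_map 0).
by rewrite !nth_default ?size_map // /toC rmorph0.
Qed.

Lemma is_digit_toC (R : realType) (n : nat) (s : seq {poly int}) (i : nat) :
  (forall k, (size (s`_k)%R < n)%N) ->
  is_digit n (toC R (\sum_(k < size s) s`_k * qint n ^+ k)) i (toC R s`_i).
Proof.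
move=> s_size; exists (map (toC R) s); last by rewrite nth_toC.
split=> [k|]; first by rewrite nth_toC size_toC.
rewrite size_map {1}/toC rmorph_sum; apply: eq_bigr => k _.
by rewrite rmorphM rmorphXn /= nth_toC.
Qed.

(** w^j and w^gcd(j,n) have the same order n/gcd(j,n), and the right-hand sides of [a_values] depend
    on the root only through its order. *)
Lemma a_values_gcd (R : realType) (A B C D : int) (w : R[i]) (m n j : nat) :
  (forall n k l : nat, 0 <= eval3 (fpoly A B C D) n k l) ->
  n.-primitive_root w ->
  let p := toC R (a (fpoly A B C D) (n * m)) in
  let v := w ^+ j in let u := w ^+ gcdn j n in
  [/\ p.[v] = (toC R (a (fpoly A B C D) (m * gcdn j n))).[1],
      p^`().[v] * v = p^`().[u] * u &
      p^`(2).[v] * v ^+ 2 = p^`(2).[u] * u ^+ 2].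
Proof.
move=> f_ge0 prim_w p v u; set g := gcdn j n.
have prim_v : (n %/ g).-primitive_root v by apply: exp_prim_root.
have prim_u : (n %/ g).-primitive_root u.
  have := exp_prim_root prim_w g.
  by have /gcdn_idPl -> : (g %| n)%N by apply: dvdn_gcdr.
have nE : (n * m = n %/ g * (m * g))%N.
  by rewrite mulnCA mulnC divnK ?dvdn_gcdr.
rewrite /p nE ![_.[_] * _]mulrC.
have [-> -> ->] := a_values f_ge0 (m * g) prim_v.
by have [_ -> ->] := a_values f_ge0 (m * g) prim_u.
Qed.

Theorem theorem2p10 (R : realType) (A B C D : int)
    (f_ge0 : forall n k l : nat, 0 <= eval3 (fpoly A B C D) n k l) :
  let f := fpoly A B C D in
  (forall (n : nat) (w : R[i]) (e : nat),
     (1 <= n)%N -> in_mu n w -> e.-primitive_root w ->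
     [/\ (toC R (a f n)).[w] = (toC R (a f (n %/ e))).[1],
         w * (toC R (a f n))^`().[w] = e%:R ^+ 2 * aP (n %/ e) (L R f) &
         w ^+ 2 * (toC R (a f n))^`(2).[w]
         = e%:R ^+ 4 * aP (n %/ e) (Q1 R f) + e%:R ^+ 2 * aP (n %/ e) (Q2 R f)])
  /\
  (forall m n : nat, (1 <= m)%N -> (2 <= n)%N -> coprime n 6 ->
     let g0 := fun d : nat => (toC R (a f (m * d))).[1] in
     let g1 := fun d : nat =>
       (toC R (a f (m * n)))^`().[omega R n ^+ d] * omega R n ^+ d in
     let g2 := fun d : nat =>
       (toC R (a f (m * n)))^`(2).[omega R n ^+ d] * omega R n ^+ (2 * d) in
     let G0 := G g0 n in
     let G1 := G g1 n in
     let G2 := G g2 n in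
     exists f0 f1 f2 : {poly int},
       [/\ congr_poly (a f (n * m)) (f0 + f1 * qint n + f2 * qint n ^+ 2)
             (qint n ^+ 3),
           [/\ is_digit n (toC R (a f (n * m))) 0 (toC R f0),
               is_digit n (toC R (a f (n * m))) 1 (toC R f1) &
               is_digit n (toC R (a f (n * m))) 2 (toC R f2)] &
           [/\ toC R f0 = G0,
               toC R f1 = n%:R^-1 *: (('X - 1) * (G1 - 'X * G0^`())) &
               toC R f2 = (2 * n%:R ^+ 2)^-1 *:
                 (('X - 1) ^+ 2 *
                  (G2 + G0^`(2) * 'X^2
                   + (n%:R - 1) *: ('X * G0^`() - G1)
                   + 2 *: ('X * (G0^`() - G1^`()))))]]).
Proof.
move=> f; split=> [n w e n1 [j wj] prim_w|m n m1 n2 cn g0 g1 g2 G0 G1 G2].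
  have en : (e %| n)%N.
    rewrite (prim_order_dvd prim_w) wj -exprM mulnC exprM.
    by rewrite (prim_expr_order (omega_prim R n1)) expr1n.
  by have := a_values f_ge0 (n %/ e) prim_w; rewrite mulnC divnK.
have n0 : (0 < n)%N by apply: ltnW.
have n5 : (5 <= n)%N.
  have := size_coprime6_dvd n0 cn (dvd1n n); rewrite divn1; apply.
  by rewrite ltn_eqF.
have prim_w := omega_prim R n0.
(* The digits are taken over the integers; interpolation then identifies their complex images with
   the closed forms. *)
have [s [s_size s_sum]] := int_digits (a f (n * m)) n2.
have tail := horner_poly_tail s (qint n).
set r := (X in _ = _ + X * _) in tail.
exists s`_0, s`_1, s`_2; split.
- by exists r; rewrite s_sum tail addrC addKr.
- by rewrite s_sum; split; apply: is_digit_toC.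
apply: (digits_interpolation (Q := toC R (qint n)) (r := toC R r)
  (p := toC R (a f (n * m))) n5 prim_w (toC_qint_mul R n)).
- by rewrite s_sum tail /toC !(rmorphD, rmorphM, rmorphXn).
- by rewrite size_toC.
- by rewrite size_toC.
- by rewrite size_toC.
- exact: size_G.
- exact: size_G.
- exact: size_G.
move=> j /andP[j0 jn] v.
have nj : ~~ (n %| j)%N by rewrite gtnNdvd.
have [V0 V1 V2] := a_values_gcd m j f_ge0 prim_w.
(* Both sides now depend on j only through gcd(j,n), where each G takes the value of its g. *)
rewrite /G0 /G1 /G2 !horner_G // -/v V0 V1 V2.
by rewrite /g0 /g1 /g2 [(m * n)%N]mulnC [(2 * _)%N]mulnC exprM.
Qed.
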